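(* Let $0<a<b$, let $f$ be a Cauchy-Stieltjes function and let $X=\mathrm{vec}^{-1}(f(\mathcal M)\,\mathrm{vec}(F))$ with $\mathcal M:=I\otimes A-B^T\otimes I$, where $A,B\in\mathbb C^{n\times n}$ are such that $A$ and $-B$ are Hermitian positive definite with spectra contained in $[a,b]$, and $F=U_FV_F^T\in\mathbb C^{n\times n}$ has rank $k$. Then for every $\ell\ge1$ the singular values of $X$ satisfy $$\sigma_{1+\ell k}(X)\le 4\,f(2a)\,\rho_{[a,2b]}^{\ell}\,\|F\|_2.$$
   Context: A function $f$ on $\mathbb C\setminus\mathbb R_-$ (with $\mathbb R_-=(-\infty,0]$) is Cauchy-Stieltjes if $f(z)=\int_0^\infty\frac{\mu(t)}{t+z}\,dt$, where $\mu(t)\,dt$ is a non-negative measure on $[0,\infty)$ ($\mu$ may be a distribution such as a Dirac delta). $\sigma_1(X)\ge\sigma_2(X)\ge\dots$ are the singular values of $X$ (with $\sigma_j(X)=0$ for $j>n$); $\|\cdot\|_2$ is the spectral norm; $\mathrm{vec}$ stacks the columns of a matrix and $\mathrm{vec}^{-1}$ is its inverse; $\otimes$ is the Kronecker product. Here $U_F,V_F\in\mathbb C^{n\times k}$. $\rho_{[a,2b]}:=\exp\left(-\frac{\pi^2}{\log(8b/a)}\right)$. *)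

(* Defs.v *)
From HB Require Import structures.
From mathcomp Require Import all_boot all_order all_algebra.
From mathcomp Require Import complex mxtens.
From mathcomp Require Import all_classical all_reals all_analysis.

Set Implicit Arguments.
Unset Strict Implicit.
Unset Printing Implicit Defensive.

Import Order.TTheory GRing.Theory Num.Theory.

Local Open Scope classical_set_scope.
Local Open Scope ring_scope.
Local Open Scope complex_scope.
Local Open Scope sesquilinear_scope.

(* The domain C \ R_-, where R_- = (-oo, 0]. *)
Definition slit_plane (R : realType) (z : R[i]) : Prop :=
  ~ (complex.Im z = 0 /\ complex.Re z <= 0).

(* The complex-valued integral is taken componentwise. The "density" mu(t) dt
   is an arbitrary non-negative Borel measure, so that Dirac masses (including
   a mass at t = 0) are allowed. The values of [f] on R_- are irrelevant. *)
Definition cauchy_stieltjes (R : realType) (f : R[i] -> R[i]) : Prop :=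
  exists mu : {measure set (measurableTypeR R) -> \bar R},
    forall z : R[i], slit_plane z ->
      let re (t : measurableTypeR R) : R := complex.Re (t%:C + z)^-1 in
      let im (t : measurableTypeR R) : R := complex.Im (t%:C + z)^-1 in
      [/\ mu.-integrable `[0, +oo[ (EFin \o re),
          mu.-integrable `[0, +oo[ (EFin \o im) &
          f z = Rintegral mu `[0, +oo[ re +i* Rintegral mu `[0, +oo[ im].

Definition posdefmx (R : realType) (n : nat) (A : 'M[R[i]]_n) : Prop :=
  A \is hermsymmx /\
  forall x : 'cV[R[i]]_n, x != 0 -> 0 < (x^t* *m A *m x) ord0 ord0.

Definition spectrum_in (R : realType) (n : nat) (a b : R) (A : 'M[R[i]]_n)
    : Prop :=
  forall x : R[i], eigenvalue A x -> a%:C <= x <= b%:C.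

(* The matrix function f(M) of a normal matrix M = P^-1 diag(d) P, with P
   unitary; the value is only meaningful when [M \is normalmx]. *)
Definition mxfun (R : realType) (n : nat) (f : R[i] -> R[i]) (M : 'M[R[i]]_n)
    : 'M[R[i]]_n :=
  invmx (spectralmx M) *m diag_mx (map_mx f (spectral_diag M)) *m spectralmx M.

(* [mxvec] stacks rows, hence the transpositions to stack columns. *)
Definition colvec (T : Type) (m n : nat) (X : 'M[T]_(m, n)) : 'cV[T]_(n * m) :=
  (mxvec X^T)^T.

Definition uncolvec (T : Type) (m n : nat) (v : 'cV[T]_(n * m)) : 'M[T]_(m, n) :=
  (vec_mx v^T)^T.

(* The matrix I (x) A - B^T (x) I representing X |-> A X - X B. *)
Definition sylvester_mx (R : realType) (n : nat) (A B : 'M[R[i]]_n)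
    : 'M[R[i]]_(n * n) :=
  tensmx (1%:M : 'M[R[i]]_n) A - tensmx B^T (1%:M : 'M[R[i]]_n).

(* The square roots of the eigenvalues of X^* X, counted with multiplicity and
   in nonincreasing order. *)
Definition singular_values (R : realType) (n : nat) (X : 'M[R[i]]_n) : seq R :=
  sort (fun x y => y <= x)
   [seq Num.sqrt (complex.Re (spectral_diag (X^t* *m X) ord0 i)) | i <- enum 'I_n].

(* Singular values are numbered from 1, and are 0 beyond n. *)
Definition sigma (R : realType) (n : nat) (j : nat) (X : 'M[R[i]]_n) : R :=
  nth 0 (singular_values X) j.-1.

Definition spectral_norm (R : realType) (n : nat) (X : 'M[R[i]]_n) : R :=
  sigma 1 X.

Definition rho (R : realType) (a b : R) : R :=
  expR (- (pi ^+ 2 / ln (4 * b / a))).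

(* Main.v *)
(** Diagonalising [A] and [- B] by unitary matrices turns [F |-> X] into the
entrywise multiplier [f (x + y)], where [x] and [y] run through the eigenvalues
[al i] of [A] and [be j] of [- B], and [f (x + y)] is the integral over [t >= 0]
of the Cauchy kernels [(t + x + y)^-1].

Zolotarev's rational functions, composed with a Moebius map, split the Cauchy
kernel on [a, +oo[ x [a, b] as
<<
  (x + y)^-1 = U x * W y / (x + y) + a sum of l rank-one terms G j x * H j y
>>
with [U] and [W] bounded by [2 * expR (- l * pi ^+ 2 / (2 * ln (8 * b / a)))].
Since [x] is unbounded here, [x] may be replaced by [t + x], and the factors
[H j] do not depend on [t]. As [F = UF *m VF^T], the rank-one terms therefore all
vanish on one subspace of codimension at most [l * k]; there only the damped
Cauchy kernels remain, each of which is a Sylvester solution operator of norm at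
most [(t + 2 * a)^-1]. Integrating over [t] gives [f (2 * a)], and Courant-Fischer
gives the bound on the singular value.

Zolotarev's bound with its explicit constant comes from theta series: the product
formulas of theta functions exhibit the Zolotarev product over [l] nodes as a
product of values of [tau] in arithmetic progression, which is at most
[tau h 0] at a smaller parameter [h]. Landen's transformation reduces the size
of [tau h 0] to [h -> 0], where it follows from the sum of the inverse squares of
the odd numbers. *)
Require Import Defs.
From HB Require Import structures.
From mathcomp Require Import all_boot all_order all_algebra.
From mathcomp Require Import complex mxtens.
From mathcomp Require Import all_classical all_reals all_analysis.
From mathcomp Require Import zify ring lra.

Import Order.TTheory GRing.Theory Num.Theory.
Import numFieldNormedType.Exports.

Set Implicit Arguments.
Unset Strict Implicit.
Unset Printing Implicit Defensive.

Local Open Scope classical_set_scope.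
Local Open Scope ring_scope.
Local Open Scope complex_scope.
Local Open Scope sesquilinear_scope.

(** * Theta series *)

Section IntSum.
Variable R : realType.
Implicit Types f g : int -> \bar R.

(** Extended real values let non-negative double series be reindexed and exchanged without any
    summability condition; finiteness is settled once, in [etheta_fin]. *)
Definition zsum f : \bar R := \esum_(n in [set: int]) f n.

Lemma zsum_ge0 f : (forall n, 0 <= f n)%E -> (0 <= zsum f)%E.
Proof. by move=> f0; apply: esum_ge0. Qed.

Lemma le_zsum f g : (forall n, f n <= g n)%E -> (zsum f <= zsum g)%E.
Proof. by move=> fg; apply: le_esum. Qed.

Lemma eq_zsum f g : f =1 g -> zsum f = zsum g.
Proof. by move=> fg; apply: eq_esum => n _. Qed.

Lemma zsumD f g : (forall n, 0 <= f n)%E -> (forall n, 0 <= g n)%E ->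
  zsum (fun n => f n + g n)%E = (zsum f + zsum g)%E.
Proof. by move=> f0 g0; apply: esumD. Qed.

Lemma zsum_reindex (h h' : int -> int) f : cancel h h' -> cancel h' h ->
  zsum f = zsum (f \o h).
Proof.
move=> hK h'K; apply: reindex_esum; split=> //.
  by move=> x y _ _ /(congr1 h'); rewrite !hK.
by move=> y _; exists (h' y).
Qed.

Lemma zsum_shift k f : zsum f = zsum (fun n => f (n + k)).
Proof.
by apply: (@zsum_reindex (fun n => n + k) (fun n => n - k)) => n;
  rewrite (addrK, subrK).
Qed.

Lemma zsum_opp f : zsum f = zsum (fun n => f (- n)).
Proof. exact: (@zsum_reindex (fun n => - n) (fun n => - n) _ opprK opprK). Qed.

Lemma zsum_parity f : (forall n, 0 <= f n)%E ->
  zsum f = (zsum (fun n => f (2 * n)%R) + zsum (fun n => f (2 * n + 1)%R))%E.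
Proof.
move=> f0; rewrite /zsum (esumID [set 2 * n | n in [set: int]])// !setTI.
rewrite (_ : ~` _ = [set 2 * n + 1 | n in [set: int]]); last first.
  apply/seteqP; split=> [n /= nP|n [m _ <-] [k _ ?]]; last by lia.
  exists (n %/ 2)%Z => //; have := divz_eq n 2; have := modz_ge0 n (d := 2).
  have := ltz_mod n (d := 2); case: (n %% 2)%Z => [[|[|]]|]//= ? ? ?; last 2 first.
  - by lia.
  - by lia.
  - by exfalso; apply: nP; exists (n %/ 2)%Z => //; lia.
  - by lia.
by congr (_ + _)%E; rewrite esum_image// => x y _ _; lia.
Qed.

Lemma zsum_exchange (G : int -> int -> \bar R) : (forall i j, 0 <= G i j)%E ->
  zsum (fun i => zsum (G i)) = zsum (fun j => zsum (fun i => G i j)).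
Proof.
move=> G0; rewrite /zsum !esum_esum//.
by apply: (@reindex_esum _ _ _ _ _ (fun x => (x.2, x.1)));
  split=> //= [[a b] [c d] _ _ [-> ->]|[a b] _]//; exists (b, a).
Qed.

Lemma zsumZl (c : R) f : (0 <= c)%R -> (forall n, 0 <= f n)%E ->
  zsum (fun n => c%:E * f n)%E = (c%:E * zsum f)%E.
Proof.
move=> c0 f0; rewrite /zsum /esum -ereal_supZl//; last first.
  apply/set0P; exists 0%E => /=; exists set0; last by rewrite fsbig_set0.
  by split; first exact: finite_set0.
congr ereal_sup; apply/seteqP; split=> [_ [X [fX XT] <-]|_ [_ [X [fX XT] <-] <-]].
  exists (\sum_(x \in X) f x); first by exists X.
  by rewrite !fsbig_finite//= ge0_sume_distrr.
exists X => //.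
by rewrite !fsbig_finite//= ge0_sume_distrr.
Qed.

(* The two terms collect the diagonals [i - j = 2 l] and [i - j = 2 l + 1]. *)
Lemma zsum_rot (G : int -> int -> \bar R) : (forall i j, 0 <= G i j)%E ->
  zsum (fun i => zsum (G i)) =
  (zsum (fun k => zsum (fun l => G (k + l)%R (k - l)%R)) +
   zsum (fun k => zsum (fun l => G (k + l + 1)%R (k - l)%R)))%E.
Proof.
move=> G0.
have -> : zsum (fun i => zsum (G i)) = zsum (fun i => zsum (fun d => G i (i - d))).
  apply: eq_zsum => i; rewrite (zsum_shift i) zsum_opp.
  by apply: eq_zsum => d; rewrite addrC.
rewrite zsum_exchange// zsum_parity; last by move=> n; apply: zsum_ge0.
congr (_ + _)%E; rewrite [RHS]zsum_exchange//; apply: eq_zsum => l.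
  by rewrite (zsum_shift l); apply: eq_zsum => k; congr G; ring.
by rewrite (zsum_shift (l + 1)); apply: eq_zsum => k; congr G; ring.
Qed.

End IntSum.

Section Theta.
Variable R : realType.
Implicit Types s t a b v w : R.

Lemma nneseries_le_bound (u : nat -> R) (M : R) : (forall n, 0 <= u n) ->
  (forall N, \sum_(0 <= i < N) u i <= M) -> (\sum_(i <oo) (u i)%:E <= M%:E)%E.
Proof.
move=> u0 uM; apply: lime_le.
  by apply: is_cvg_nneseries => n _ _; rewrite lee_fin.
by apply: nearW => N; rewrite sumEFin lee_fin.
Qed.

Lemma zsum_nat (f : int -> \bar R) : (forall n, 0 <= f n)%E ->
  zsum f = (f 0%R + \sum_(n <oo) f n.+1%:Z + \sum_(n <oo) f (- n.+1%:Z)%R)%E.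
Proof.
move=> f0; rewrite /zsum (esumID [set 0])// setTI esum_set1// setTI -addeA.
congr (_ + _)%E; rewrite (esumID [set n.+1%:Z | n in [set: nat]])//.
rewrite (_ : _ `&` _ = [set n.+1%:Z | n in [set: nat]]); last first.
  by apply/seteqP; split=> [n []//|n [m _ <-]]; split=> //; exists m.
rewrite (_ : _ `&` ~` _ = [set - n.+1%:Z | n in [set: nat]]); last first.
  apply/seteqP; split=> [n [/= n0 nP]|n [m _ <-]]; last first.
    by split=> [|[k _]] /=; lia.
  case: n n0 nP => [[|n]|n] n0 nP; first by exfalso; apply: n0.
    by exfalso; apply: nP; exists n.
  by exists n.
by rewrite !esum_image -?nneseries_esumT// => x y _ _ /=; lia.
Qed.

(** The terms of Jacobi's theta function with nome [expR (- s)], at a purely imaginary argument, so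
    that every term is positive. *)
Definition theta_term s t (n : int) : R := expR (- s * n%:~R ^+ 2 + n%:~R * t).

Definition etheta s t : \bar R := zsum (fun n => (theta_term s t n)%:E).

Definition theta s t : R := fine (etheta s t).

Lemma theta_term_gt0 s t n : 0 < theta_term s t n.
Proof. exact: expR_gt0. Qed.

Lemma theta_term_ge0 s t n : (0 <= (theta_term s t n)%:E)%E.
Proof. by rewrite lee_fin expR_ge0. Qed.
Hint Resolve theta_term_ge0 : core.

Lemma theta_termN s t n : theta_term s t (- n) = theta_term s (- t) n.
Proof. by congr expR; rewrite mulrNz; ring. Qed.

(** Once [- s * n + t <= - ln 2], the terms lie below a geometric series of ratio 1/2; the constant
    [C] absorbs the finitely many earlier ones. *)
Lemma theta_half_bound s t : 0 < s ->
  exists M, (\sum_(n <oo) (theta_term s t n.+1%:Z)%:E <= M%:E)%E.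
Proof.
move=> s0; have [K HK] : exists K : nat, forall n : nat, (K <= n)%N ->
    - s * n%:R + t <= - ln 2.
  exists (Num.truncn ((t + ln 2) / s)).+1 => n Kn.
  suff : (t + ln 2) / s <= n%:R by rewrite ler_pdivrMr//; lra.
  apply: le_trans (ltW (truncnS_gt _)) _.
  by rewrite ler_nat.
pose C := expR (K%:R * (`|t| + ln 2)); exists C.
have ln2 : 0 <= ln 2 :> R by rewrite ln_ge0// ler1n.
have term n : theta_term s t n.+1%:Z <= C * (2^-1) ^+ n.+1.
  have -> : (2^-1 : R) = expR (- ln 2) by rewrite expRN lnK// posrE.
  rewrite -expRM_natl -expRD ler_expR /=.
  have -> : - s * n.+1%:~R ^+ 2 + n.+1%:~R * t = n.+1%:R * (- s * n.+1%:R + t) :> R.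
    by rewrite -pmulrn; ring.
  have [nK|Kn] := leqP K n.+1.
    apply: (@le_trans _ _ (n.+1%:R * (- ln 2))); first by rewrite ler_wpM2l ?HK.
    by rewrite mulrN lerDr mulr_ge0// addr_ge0.
  apply: (@le_trans _ _ (n.+1%:R * (`|t| + ln 2) - n.+1%:R * ln 2)).
    rewrite [X in _ <= X - _]mulrDr addrK ler_wpM2l//.
    have : 0 <= s * n.+1%:R by rewrite mulr_ge0 // ltW.
    by have := ler_norm t; lra.
  rewrite mulrN lerD2r ler_wpM2r ?addr_ge0// ler_nat; exact: ltnW.
apply: nneseries_le_bound => [n|N]; first exact: ltW (theta_term_gt0 _ _ _).
apply: (@le_trans _ _ (\sum_(0 <= i < N) C * 2^-1 ^+ i.+1)).
  by apply: ler_sum => i _; exact: term.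
rewrite -mulr_sumr -[leRHS]mulr1 ler_wpM2l ?expR_ge0//.
rewrite (_ : \sum_(0 <= i < N) _ = 1 - 2^-1 ^+ N); first by rewrite gerBl exprn_ge0.
elim: N => [|N IH]; first by rewrite big_nil expr0 subrr.
by rewrite big_nat_recr//= IH exprS; lra.
Qed.

Lemma etheta_fin s t : 0 < s -> etheta s t \is a fin_num.
Proof.
move=> s0; rewrite /etheta zsum_nat//.
have [M1 H1] := theta_half_bound t s0; have [M2 H2] := theta_half_bound (- t) s0.
rewrite !fin_numD /=; apply/andP; split; last first.
  under eq_eseriesr do rewrite theta_termN.
  rewrite ge0_fin_numE; last exact: nneseries_ge0.
  exact: le_lt_trans H2 (ltry _).
by rewrite ge0_fin_numE; [exact: le_lt_trans H1 (ltry _)|exact: nneseries_ge0].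
Qed.

Lemma thetaE s t : 0 < s -> (theta s t)%:E = etheta s t.
Proof. by move=> s0; rewrite fineK// etheta_fin. Qed.

Lemma theta_ge1 s t : 0 < s -> 1 <= theta s t.
Proof.
move=> s0; rewrite -lee_fin thetaE// /etheta zsum_nat//.
rewrite (_ : theta_term s t 0 = 1) -?addeA ?leeDl ?adde_ge0 ?nneseries_ge0//.
by rewrite /theta_term expr0n/= mulr0 mul0r addr0 expR0.
Qed.

Lemma theta_gt0 s t : 0 < s -> 0 < theta s t.
Proof. by move=> s0; apply: lt_le_trans (theta_ge1 t s0). Qed.

Lemma thetaN s t : theta s (- t) = theta s t.
Proof.
rewrite /theta /etheta zsum_opp; congr fine.
by apply: eq_zsum => n; rewrite theta_termN opprK.
Qed.

(** Quasi-periodicity: complete the square after moving the index by one. *)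
Lemma theta_shift s t : 0 < s -> theta s (t - 2 * s) = expR (s - t) * theta s t.
Proof.
move=> s0; apply: EFin_inj; rewrite EFinM !thetaE// -zsumZl ?expR_ge0//.
rewrite [in RHS](zsum_shift 1); apply: eq_zsum => n.
rewrite -EFinM -expRD /theta_term; congr (expR _)%:E.
by rewrite intrD; ring.
Qed.

(** The subseries over even and over odd indices, each rewritten as a theta series of parameter
    [4 * s]. *)
Definition theta_even s t := theta (4 * s) (2 * t).
Definition theta_odd s t := expR (t - s) * theta (4 * s) (2 * t - 4 * s).

Lemma theta_evenE s t : 0 < s ->
  (theta_even s t)%:E = zsum (fun n => (theta_term s t (2 * n))%:E).
Proof.
move=> s0; rewrite thetaE ?mulr_gt0//; apply: eq_zsum => n; congr (expR _)%:E.
by rewrite intrM; ring.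
Qed.

Lemma theta_oddE s t : 0 < s ->
  (theta_odd s t)%:E = zsum (fun n => (theta_term s t (2 * n + 1))%:E).
Proof.
move=> s0; rewrite EFinM thetaE ?mulr_gt0// -zsumZl ?expR_ge0//.
apply: eq_zsum => n; rewrite -EFinM -expRD; congr (expR _)%:E.
by rewrite intrD intrM; ring.
Qed.

Lemma theta_evenDodd s t : 0 < s -> theta s t = theta_even s t + theta_odd s t.
Proof.
move=> s0; apply: EFin_inj.
rewrite EFinD (theta_evenE t s0) (theta_oddE t s0) (thetaE t s0).
by rewrite -(zsum_parity (theta_term_ge0 s t)).
Qed.

Lemma theta_even_gt0 s t : 0 < s -> 0 < theta_even s t.
Proof. by move=> s0; rewrite theta_gt0// mulr_gt0. Qed.

Lemma theta_odd_gt0 s t : 0 < s -> 0 < theta_odd s t.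
Proof. by move=> s0; rewrite mulr_gt0 ?expR_gt0 ?theta_gt0// mulr_gt0. Qed.

Lemma zsumM (f g : int -> R) (F G : R) : (forall n, 0 <= f n) ->
  (forall n, 0 <= g n) ->
  F%:E = zsum (fun n => (f n)%:E) -> G%:E = zsum (fun n => (g n)%:E) ->
  (F * G)%:E = zsum (fun i => zsum (fun j => (f i * g j)%:E)).
Proof.
move=> f0 g0 FE GE.
have G0 : 0 <= G by rewrite -lee_fin GE zsum_ge0// => n; rewrite lee_fin.
rewrite mulrC EFinM FE -zsumZl//.
by apply: eq_zsum => n; rewrite muleC GE -zsumZl.
Qed.

Let pos s t (h : int -> int) n : 0 <= theta_term s t (h n).
Proof. exact: ltW (theta_term_gt0 _ _ _). Qed.

(* The product of two theta series is summed along the lattice of the [m, n]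
   with [m + n] even, resp. odd. *)
Lemma theta_mul_even s a b : 0 < s ->
  theta_even s a * theta_even s b + theta_odd s a * theta_odd s b =
  theta (2 * s) (a + b) * theta (2 * s) (a - b).
Proof.
move=> s0; have s20 : 0 < 2 * s by rewrite mulr_gt0.
apply: EFin_inj; rewrite EFinD.
rewrite (zsumM (pos s a _) (pos s b _) (theta_evenE _ s0) (theta_evenE _ s0)).
rewrite (zsumM (pos s a _) (pos s b _) (theta_oddE _ s0) (theta_oddE _ s0)).
rewrite (zsumM (pos _ _ id) (pos _ _ id) (thetaE _ s20) (thetaE _ s20)).
rewrite [RHS]zsum_rot => [|i j]; last by rewrite lee_fin mulr_ge0 ?(ltW (theta_term_gt0 _ _ _)).
congr (_ + _)%E; apply: eq_zsum => k; apply: eq_zsum => l; congr _%:E;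
  rewrite -!expRD; congr expR; rewrite !(intrD, intrM, mulrNz); ring.
Qed.

Lemma theta_mul_odd s a b : 0 < s ->
  theta_even s a * theta_odd s b + theta_odd s a * theta_even s b =
  expR (a - s) * (theta (2 * s) (a + b - 2 * s) * theta (2 * s) (a - b - 2 * s)).
Proof.
move=> s0; have s20 : 0 < 2 * s by rewrite mulr_gt0.
apply: EFin_inj; rewrite EFinD [in RHS]EFinM.
rewrite (zsumM (pos s a _) (pos s b _) (theta_evenE _ s0) (theta_oddE _ s0)).
rewrite (zsumM (pos s a _) (pos s b _) (theta_oddE _ s0) (theta_evenE _ s0)).
rewrite (zsumM (pos _ _ id) (pos _ _ id) (thetaE _ s20) (thetaE _ s20)).
rewrite [X in _ = (_ * X)%E]zsum_rot => [|i j]; last by rewrite lee_fin mulr_ge0 ?(ltW (theta_term_gt0 _ _ _)).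
rewrite ge0_muleDr ?zsum_ge0//; last 2 first.
- by move=> n; apply: zsum_ge0 => j; rewrite lee_fin mulr_ge0 ?(ltW (theta_term_gt0 _ _ _)).
- by move=> n; apply: zsum_ge0 => j; rewrite lee_fin mulr_ge0 ?(ltW (theta_term_gt0 _ _ _)).
rewrite -!zsumZl ?expR_ge0//; last 2 first.
- by move=> n; apply: zsum_ge0 => j; rewrite lee_fin mulr_ge0 ?(ltW (theta_term_gt0 _ _ _)).
- by move=> n; apply: zsum_ge0 => j; rewrite lee_fin mulr_ge0 ?(ltW (theta_term_gt0 _ _ _)).
(* The odd-even product is the first half of the rotated sum; the even-odd product is the second
   half, once its outer index is moved by one. *)
rewrite addeC [X in (_ + X)%E = _](zsum_shift 1).
congr (_ + _)%E; apply: eq_zsum => k;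
  (rewrite -zsumZl ?expR_ge0//; last by move=> j; rewrite lee_fin mulr_ge0);
  apply: eq_zsum => l; rewrite -EFinM; congr _%:E;
  rewrite -!expRD; congr expR; rewrite !(intrD, intrM, mulrNz); ring.
Qed.

End Theta.

(** * Zolotarev's extremal function as a quotient of theta series *)

Section Tau.
Variable R : realType.
Implicit Types s t a b v w : R.

Lemma theta_shift2 s t : 0 < s ->
  theta s (t + s) = expR t * theta s (t - s).
Proof.
move=> s0; rewrite (_ : t - s = t + s - 2 * s); last by ring.
rewrite theta_shift// mulrA -expRD (_ : t + (s - (t + s)) = 0); last by ring.
by rewrite expR0 mul1r.
Qed.

(* The theta series at [- e^t]. *)
Definition theta_alt s t := theta_even s t - theta_odd s t.

Definition tau s t := theta_alt s t / theta s t.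

Lemma theta_even_shift s t : 0 < s ->
  theta_even s (t - 2 * s) = expR (s - t) * theta_odd s t.
Proof.
move=> s0; rewrite /theta_even /theta_odd mulrA -expRD.
rewrite (_ : s - t + (t - s) = 0) ?expR0 ?mul1r; last by ring.
by congr theta; ring.
Qed.

Lemma theta_odd_shift s t : 0 < s ->
  theta_odd s (t - 2 * s) = expR (s - t) * theta_even s t.
Proof.
move=> s0; rewrite /theta_even /theta_odd.
rewrite (_ : 2 * (t - 2 * s) - 4 * s = 2 * t - 2 * (4 * s)); last by ring.
by rewrite theta_shift ?mulr_gt0// mulrA -expRD; congr (expR _ * _); ring.
Qed.

Lemma theta_evenN s t : theta_even s (- t) = theta_even s t.
Proof. by rewrite /theta_even mulrN thetaN. Qed.

Lemma theta_oddN s t : 0 < s -> theta_odd s (- t) = theta_odd s t.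
Proof.
move=> s0; rewrite /theta_odd.
rewrite (_ : 2 * - t - 4 * s = - (2 * t + 4 * s)); last by ring.
rewrite thetaN theta_shift2 ?mulr_gt0// mulrA -expRD.
by congr (expR _ * _); ring.
Qed.

Lemma tauN s t : 0 < s -> tau s (- t) = tau s t.
Proof.
by move=> s0; rewrite /tau /theta_alt theta_evenN theta_oddN// thetaN.
Qed.

(** The shift exchanges the even and the odd part up to the common factor [expR (s - t)]: the
    numerator changes sign relative to the denominator. *)
Lemma tau_shift s t : 0 < s -> tau s (t - 2 * s) = - tau s t.
Proof.
move=> s0; rewrite /tau /theta_alt theta_even_shift// theta_odd_shift//.
rewrite theta_shift// -mulrBr -mulNr opprB invfM mulrACA divff ?mul1r//.
exact: lt0r_neq0 (expR_gt0 _).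
Qed.

(* By the product formulas, numerators and denominators of the two sides agree
   up to the common factor [theta (4 * s) (2 * s)]. *)
Lemma tau_double s t : 0 < s -> tau s t = tau (2 * s) (t - s) * tau (2 * s) (t + s).
Proof.
move=> s0; have s20 : 0 < 2 * s by rewrite mulr_gt0.
have K0 : 0 < theta (4 * s) (2 * s) by rewrite theta_gt0 ?mulr_gt0.
have := theta_mul_even (t - s) (t + s) s20.
have := theta_mul_odd (t - s) (t + s) s20.
rewrite (_ : t - s + (t + s) = 2 * t); last by ring.
rewrite (_ : t - s - (t + s) = - (2 * s)); last by ring.
rewrite (_ : 2 * (2 * s) = 4 * s); last by ring.
have -> : theta (4 * s) (- (2 * s) - 4 * s) = expR (2 * s) * theta (4 * s) (2 * s).
  rewrite -opprD thetaN theta_shift2 ?mulr_gt0// -(thetaN _ (2 * s)).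
  by congr (_ * theta _ _); ring.
rewrite thetaN.
rewrite (_ : expR _ * _ = theta_odd s t * theta (4 * s) (2 * s)); last first.
  rewrite /theta_odd (_ : expR (t - s) = expR (t - s - 2 * s) * expR (2 * s)).
    by ring.
  by rewrite -expRD; congr expR; ring.
rewrite -/(theta_even s t) => H1 H2.
rewrite /tau /theta_alt mulrACA -invfM !theta_evenDodd//.
set e1 := theta_even (2 * s) (t - s) in H1 H2 *.
set o1 := theta_odd (2 * s) (t - s) in H1 H2 *.
set e2 := theta_even (2 * s) (t + s) in H1 H2 *.
set o2 := theta_odd (2 * s) (t + s) in H1 H2 *.
rewrite (_ : (e1 - o1) * (e2 - o2) = (theta_even s t - theta_odd s t) * theta (4 * s) (2 * s)); last first.
  rewrite [RHS]mulrBl -H1 -H2; ring.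
rewrite (_ : (e1 + o1) * (e2 + o2) = (theta_even s t + theta_odd s t) * theta (4 * s) (2 * s)); last first.
  rewrite [RHS]mulrDl -H1 -H2; ring.
by rewrite -mulf_div divff ?mulr1 ?gt_eqF.
Qed.

(* The inequality drops a factor from Landen's transformation at [t = 0]. *)
Lemma tau_landen s : 0 < s -> tau (2 * s) 0 ^+ 2 <= 2 * tau s 0.
Proof.
move=> s0; have s20 : 0 < 2 * s by rewrite mulr_gt0.
have := theta_mul_even 0 0 s0; have := theta_mul_even 0 0 s20.
have := theta_mul_odd 0 0 s20.
rewrite subrr add0r /tau => H1 H2; rewrite addr0 => H3.
have eE : theta_even s 0 = theta (4 * s) 0 by rewrite /theta_even mulr0.
have oE : theta_odd s 0 = expR (- s) * theta (4 * s) (- (4 * s)).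
  by rewrite /theta_odd mulr0 !add0r.
have altE : theta_alt (2 * s) 0 ^+ 2 = theta_even s 0 ^+ 2 - theta_odd s 0 ^+ 2.
  rewrite /theta_alt (_ : (_ - _) ^+ 2 =
    (theta_even (2 * s) 0 * theta_even (2 * s) 0 +
     theta_odd (2 * s) 0 * theta_odd (2 * s) 0) -
    (theta_even (2 * s) 0 * theta_odd (2 * s) 0 +
     theta_odd (2 * s) 0 * theta_even (2 * s) 0)); last by ring.
  rewrite H1 H2 eE oE !add0r (_ : 2 * (2 * s) = 4 * s); last by ring.
  rewrite exprMn (_ : expR (- s) ^+ 2 = expR (- (2 * s))) ?expr2//.
  by rewrite -expRD; congr expR; ring.
have : 0 <= theta_even s 0 ^+ 2 - theta_odd s 0 ^+ 2 by rewrite -altE sqr_ge0.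
rewrite expr_div_n altE (expr2 (theta (2 * s) 0)) -H3 /theta_alt theta_evenDodd//.
have e0 := theta_even_gt0 0 s0; have o0 := theta_odd_gt0 0 s0.
move: (theta_even s 0) (theta_odd s 0) e0 o0 => e o e0 o0.
rewrite subr_sqr pmulr_lge0 ?addr_gt0// => eo0.
rewrite ler_pdivrMr ?addr_gt0 ?mulr_gt0//.
have -> : (e - o) * (e + o) = (e - o) / (e + o) * (e + o) ^+ 2.
  by field; rewrite gt_eqF ?addr_gt0.
rewrite [leRHS](_ : _ = (e - o) / (e + o) * (2 * (e * e + o * o))); last by ring.
apply: ler_wpM2l; first by rewrite divr_ge0// ltW// addr_gt0.
by rewrite -subr_ge0 (_ : _ - _ = (e - o) ^+ 2) ?sqr_ge0//; ring.
Qed.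

Lemma tau0_ge0 s : 0 < s -> 0 <= tau s 0.
Proof.
move=> s0; have := tau_landen s0.
by rewrite -(pmulr_rge0 _ (ltr0n R 2)); apply: le_trans; exact: sqr_ge0.
Qed.

(* The elliptic function (a [dn], up to scaling) whose values at points in
   arithmetic progression are the Zolotarev nodes. *)
Definition zol s v := theta (2 * s) (2 * v) / (expR v * theta (2 * s) (2 * v - 2 * s)).

Lemma zol_gt0 s v : 0 < s -> 0 < zol s v.
Proof.
move=> s0; have s20 : 0 < 2 * s by rewrite mulr_gt0.
by rewrite divr_gt0 ?mulr_gt0 ?expR_gt0 ?theta_gt0.
Qed.

(** Write [e1, o1] and [e2, o2] for the even and odd parts at [v + w - s] and [v - w - s]. By the
    product formulas [e1 * e2 + o1 * o2] and [e1 * o2 + o1 * e2] are in the ratio of [zol s w] to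
    [zol s v]; their difference and sum factor into the numerators and denominators of the two
    values of [tau]. *)
Lemma zol_tau s v w : 0 < s ->
  (zol s w - zol s v) / (zol s w + zol s v) = tau s (v + w - s) * tau s (v - w - s).
Proof.
move=> s0; have s20 : 0 < 2 * s by rewrite mulr_gt0.
have := theta_mul_even (v + w - s) (v - w - s) s0.
have := theta_mul_odd (v + w - s) (v - w - s) s0.
rewrite (_ : v + w - s + (v - w - s) = 2 * v - 2 * s); last by ring.
rewrite (_ : v + w - s - (v - w - s) = 2 * w); last by ring.
have -> : theta (2 * s) (2 * v - 2 * s - 2 * s) =
    expR (2 * s - 2 * v) * theta (2 * s) (2 * v).
  by rewrite -theta_shift//; congr theta; ring.
have -> : expR (v + w - s - s) * (expR (2 * s - 2 * v) * theta (2 * s) (2 * v) *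
    theta (2 * s) (2 * w - 2 * s)) =
    expR (- v) * (theta (2 * s) (2 * v) * (expR w * theta (2 * s) (2 * w - 2 * s))).
  rewrite (_ : expR (- v) = expR (v + w - s - s) * expR (2 * s - 2 * v) * expR (- w)).
    by rewrite expRN; field; rewrite gt_eqF ?expR_gt0.
  by rewrite -!expRD; congr expR; ring.
have -> : theta (2 * s) (2 * v - 2 * s) * theta (2 * s) (2 * w) =
    expR (- v) * ((expR v * theta (2 * s) (2 * v - 2 * s)) * theta (2 * s) (2 * w)).
  by rewrite expRN; field; rewrite gt_eqF ?expR_gt0.
move=> H1 H2; rewrite /tau /theta_alt mulrACA -invfM !theta_evenDodd//.
set e1 := theta_even s (v + w - s) in H1 H2 *.
set o1 := theta_odd s (v + w - s) in H1 H2 *.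
set e2 := theta_even s (v - w - s) in H1 H2 *.
set o2 := theta_odd s (v - w - s) in H1 H2 *.
rewrite (_ : (e1 - o1) * (e2 - o2) = e1 * e2 + o1 * o2 - (e1 * o2 + o1 * e2));
  last by ring.
rewrite (_ : (e1 + o1) * (e2 + o2) = e1 * e2 + o1 * o2 + (e1 * o2 + o1 * e2));
  last by ring.
rewrite H1 H2 /zol.
have := expR_gt0 (- v); have := theta_gt0 (2 * v) s20; have := theta_gt0 (2 * w) s20.
have : 0 < expR v * theta (2 * s) (2 * v - 2 * s) by rewrite mulr_gt0 ?expR_gt0 ?theta_gt0.
have : 0 < expR w * theta (2 * s) (2 * w - 2 * s) by rewrite mulr_gt0 ?expR_gt0 ?theta_gt0.
move: (theta (2 * s) (2 * v)) (theta (2 * s) (2 * w)) (expR v * _) (expR w * _) (expR (- v)).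
move=> X X' Y Y' c Y'0 Y0 X'0 X0 c0; field.
rewrite !gt_eqF ?addr_gt0 ?mulr_gt0//.
Qed.

(** At [w = 0] the right-hand side of [zol_tau] is a square. *)
Lemma zol_le0 s v : 0 < s -> zol s v <= zol s 0.
Proof.
move=> s0; have := zol_tau v 0 s0; rewrite addr0 subr0 -expr2 => H.
have : 0 <= (zol s 0 - zol s v) / (zol s 0 + zol s v) by rewrite H sqr_ge0.
by rewrite pmulr_lge0 ?subr_ge0// invr_gt0 addr_gt0 ?zol_gt0.
Qed.

Lemma theta_odd_even s v : 0 < s ->
  theta_odd s v / theta_even s v = expR (- s) / zol (2 * s) v.
Proof.
move=> s0; rewrite /theta_odd /theta_even /zol (_ : 2 * (2 * s) = 4 * s); last by ring.
rewrite invf_div mulrA; congr (_ / _); rewrite mulrA -expRD addrC.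
by congr (expR _ * _); ring.
Qed.

Lemma tauE s v : 0 < s ->
  tau s v = (1 - theta_odd s v / theta_even s v) / (1 + theta_odd s v / theta_even s v).
Proof.
move=> s0; rewrite /tau /theta_alt theta_evenDodd//.
have e0 := theta_even_gt0 v s0; have o0 := theta_odd_gt0 v s0.
by field; rewrite !gt_eqF ?addr_gt0.
Qed.

(** [tau s] decreases in the quotient of odd by even part, which is [expR (- s) / zol (2 * s) v] and
    hence least at [v = 0]. *)
Lemma tau_le0 s v : 0 < s -> tau s v <= tau s 0.
Proof.
move=> s0; have s20 : 0 < 2 * s by rewrite mulr_gt0.
rewrite !tauE// !theta_odd_even//.
have : expR (- s) / zol (2 * s) 0 <= expR (- s) / zol (2 * s) v.
  by rewrite ler_wpM2l ?expR_ge0// lef_pV2 ?posrE ?zol_gt0// zol_le0.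
have : 0 < expR (- s) / zol (2 * s) 0 by rewrite divr_gt0 ?expR_gt0 ?zol_gt0.
set x := expR (- s) / zol (2 * s) 0; set y := expR (- s) / zol (2 * s) v.
move=> x0 xy; have y0 : 0 < y by exact: lt_le_trans xy.
rewrite ler_pdivrMr ?addr_gt0// mulrAC ler_pdivlMr ?addr_gt0//; nra.
Qed.

Lemma tau_abs_le0 s v : 0 < s -> `|tau s v| <= tau s 0.
Proof.
by move=> s0; rewrite ler_norml lerNl -tau_shift// !tau_le0.
Qed.

(** Ensures that [zol s / zol s 0] covers [[4 * expR (- s), 1]] as its argument runs through
    [[0, s]]. After clearing denominators the claim is the square of [H]. *)
Lemma zol_ratio s : 0 < s -> zol s s <= 4 * expR (- s) * zol s 0.
Proof.
move=> s0; have s20 : 0 < 2 * s by rewrite mulr_gt0.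
(* The left exponents are [- 2 s n (n - 1)], and [n (n - 1)] is at least [n ^ 2] for [n <= 0] and at
   least [(n - 1) ^ 2] for [n >= 1]. Each term on the left is thus at most the sum of two
   neighbouring terms on the right. *)
have H : theta (2 * s) (2 * s) <= 2 * theta (2 * s) 0.
  rewrite -lee_fin EFinM !thetaE// -zsumZl//; last first.
    by move=> n; rewrite lee_fin expR_ge0.
  rewrite /etheta.
  have -> : zsum (fun n => (2%:E * (theta_term (2 * s) 0 n)%:E)%E) =
      (zsum (fun n => (theta_term (2 * s) 0 n)%:E) +
       zsum (fun n => (theta_term (2 * s) 0 (n - 1))%:E))%E.
    rewrite -(zsum_shift (-1) (fun n => (theta_term (2 * s) 0 n)%:E)).
    rewrite zsumZl//; last by move=> n; rewrite lee_fin expR_ge0.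
    by rewrite -[X in X%:E]/(1 + 1) EFinD ge0_muleDl ?lee_fin// mul1e.
  rewrite -zsumD; last 2 first.
  - by move=> n; rewrite lee_fin expR_ge0.
  - by move=> n; rewrite lee_fin expR_ge0.
  apply: le_zsum => n; rewrite -EFinD lee_fin /theta_term !mulr0 !addr0.
  have [n0|n0] := lerP n 0.
    apply: (@le_trans _ _ (expR (- (2 * s) * n%:~R ^+ 2))); last by rewrite lerDl expR_ge0.
    by rewrite ler_expR gerDl mulr_le0_ge0 ?lerz0// ltW.
  apply: (@le_trans _ _ (expR (- (2 * s) * (n - 1)%:~R ^+ 2))); last by rewrite lerDr expR_ge0.
  rewrite ler_expR intrB -subr_ge0.
  rewrite (_ : _ - _ = 2 * s * (n%:~R - 1)); last by ring.
  by rewrite mulr_ge0 ?(ltW s20)// subr_ge0 ler1z.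
rewrite /zol mulr0 sub0r thetaN expR0 mul1r subrr.
have X0 := theta_gt0 0 s20; have Y0 := theta_gt0 (2 * s) s20.
have e0 := expR_gt0 s; rewrite expRN.
rewrite ler_pdivrMr ?mulr_gt0//.
rewrite (_ : 4 * _^-1 * _ * _ = (2 * theta (2 * s) 0) ^+ 2 / theta (2 * s) (2 * s)); last first.
  by field; rewrite !gt_eqF.
by rewrite ler_pdivlMr// -expr2 ler_sqr ?nnegrE ?mulr_ge0// ltW.
Qed.

End Tau.

(** * Product expansion *)

Section TauProduct.
Variable R : realType.
Implicit Types s t u v y : R.

Lemma theta_ge s t : 0 < s -> 1 + expR (- s - t) <= theta s t.
Proof.
move=> s0; rewrite -lee_fin thetaE// /etheta zsum_nat; last exact: theta_term_ge0.
rewrite (_ : theta_term s t 0 = 1); last first.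
  by rewrite /theta_term expr0n/= mulr0 mul0r addr0 expR0.
rewrite EFinD leeD//; last first.
  apply: le_trans (nneseries_lim_ge 1 _) => [|n _ _]; last exact: theta_term_ge0.
  rewrite big_nat1 /theta_term lee_fin ler_expR /=.
  by rewrite mulrNz expr2 mulrNN; lra.
by rewrite leeDl// nneseries_ge0// => n _ _; exact: theta_term_ge0.
Qed.

(** As [t <= s], the term of index [m] is at most [expR (- s)] to the power [m (m - 1)]; from
    [m = 2] on, a geometric series of ratio at most 1/2 dominates. *)
Lemma theta_half_le s t : expR (- s) <= 2^-1 -> t <= s ->
  (\sum_(n <oo) (theta_term s t n.+1%:Z)%:E <=
   (expR (t - s) + 2 * expR (- s) ^+ 2)%:E)%E.
Proof.
move=> Q2 ts; have s0 : 0 <= s.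
  by rewrite -[s]opprK oppr_ge0 -ler_expR expR0 (le_trans Q2)// invf_le1// ler1n.
have term n : theta_term s t n.+2%:Z <= 2 * expR (- s) ^+ 2 * 2^-1 ^+ n.+1.
  apply: (@le_trans _ _ (expR (- s) ^+ 2 * expR (- s) ^+ n)).
    rewrite -exprD -expRM_natl /theta_term ler_expR /= -!pmulrn.
    have : 0 <= n%:R :> R by [].
    rewrite -[n.+2]addn2 (addnC 2) natrD; move: (n%:R) => x x0.
    by nra.
  rewrite -mulrA [leRHS]mulrCA ler_wpM2l ?sqr_ge0// exprS mulrA divff ?mul1r//.
  by rewrite lerXn2r ?nnegrE ?expR_ge0// invr_ge0.
apply: nneseries_le_bound => [n|N]; first exact: ltW (theta_term_gt0 _ _ _).
case: N => [|N]; first by rewrite big_nil addr_ge0 ?expR_ge0// mulr_ge0 ?sqr_ge0.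
rewrite big_nat_recl//= lerD//.
  by rewrite /theta_term ler_expR expr1n; lra.
apply: (@le_trans _ _ (\sum_(0 <= i < N) 2 * expR (- s) ^+ 2 * 2^-1 ^+ i.+1)).
  by apply: ler_sum => i _; exact: term.
rewrite -mulr_sumr -[leRHS]mulr1 ler_wpM2l ?mulr_ge0 ?sqr_ge0//.
rewrite (_ : \sum_(0 <= i < N) _ = 1 - 2^-1 ^+ N); first by rewrite gerBl exprn_ge0.
elim: N => [|N IH]; first by rewrite big_nil expr0 subrr.
by rewrite big_nat_recr//= IH exprS; lra.
Qed.

Lemma theta_le s t : 0 < s -> expR (- s) <= 2^-1 -> `|t| <= s ->
  theta s t <= 1 + expR (t - s) + expR (- t - s) + 4 * expR (- s) ^+ 2.
Proof.
move=> s0 Q2; rewrite ler_norml => /andP[t1 t2].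
rewrite -lee_fin thetaE// /etheta zsum_nat; last exact: theta_term_ge0.
rewrite (_ : theta_term s t 0 = 1); last first.
  by rewrite /theta_term expr0n/= mulr0 mul0r addr0 expR0.
rewrite (_ : 1 + _ + _ + _ = 1 + (expR (t - s) + 2 * expR (- s) ^+ 2) +
  (expR (- t - s) + 2 * expR (- s) ^+ 2)); last by ring.
rewrite !EFinD leeD//; first by rewrite leeD//; exact: theta_half_le.
under eq_eseriesr do rewrite theta_termN.
by apply: theta_half_le => //; lra.
Qed.

(** The Cayley transform, also [exp (- 2 artanh y)]. For large [s], [tau s t] is close to the
    product of its values at [expR (t - s)] and [expR (- t - s)]. *)
Definition cay y := (1 - y) / (1 + y).

Lemma cay_ge0 y : 0 <= y <= 1 -> 0 <= cay y.
Proof. by move=> /andP[y0 y1]; rewrite divr_ge0 ?subr_ge0 ?addr_ge0. Qed.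

Lemma cay_le1 y : 0 <= y -> cay y <= 1.
Proof. by move=> y0; rewrite ler_pdivrMr ?mul1r; [lra|rewrite ltr_wpDr]. Qed.

(* Both bounds follow from [1 <= e], [u + v <= o], [e + o <= 1 + u + v + 4 w]. *)
Lemma cay_approx (u v w e o d : R) : 0 <= u -> 0 <= v -> u * v = w -> u < 1 -> v < 1 ->
  d <= (1 - u) * (1 - v) -> 0 < d -> 18 * w <= d ->
  1 <= e -> u + v <= o -> e + o <= 1 + u + v + 4 * w ->
  (e - o) / (e + o) <= expR (18 * w / d) * (cay u * cay v) /\
  cay u * cay v <= expR (18 * w / d) * ((e - o) / (e + o)).
Proof.
move=> u0 v0 uv u1 v1 dN d0 wd e1 o1 eo.
have w0 : 0 <= w by rewrite -uv mulr_ge0.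
rewrite /cay mulrACA -invfM.
set N := (1 - u) * (1 - v) in dN *; set D := (1 + u) * (1 + v).
have NE : N = 1 - u - v + w by rewrite /N -uv; ring.
have DE : D = 1 + u + v + w by rewrite /D -uv; ring.
have N0 : 0 < N by exact: lt_le_trans dN.
have D1 : 1 <= D by lra.
have D0 : 0 < D by lra.
have eo0 : 0 < e + o by lra.
have d1 : d <= 1 by nra.
pose x := w / d; have x0 : 0 <= x by rewrite divr_ge0// ltW.
have x1 : 18 * x <= 1 by rewrite mulrA ler_pdivrMr// mul1r.
have wx : w = x * d by rewrite divfK// gt_eqF.
have wN : w <= x * N by rewrite wx ler_wpM2l.
have wx1 : w <= x by rewrite wx -[leRHS]mulr1 ler_wpM2l.
have E : 1 + 18 * x <= expR (18 * w / d) by rewrite -mulrA expR_ge1Dx.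
have ND0 : 0 <= N / D by rewrite divr_ge0// ltW.
split.
  apply: (@le_trans _ _ ((1 + 18 * x) * (N / D))); last by rewrite ler_wpM2r.
  rewrite ler_pdivrMr// mulrA mulrAC ler_pdivlMr//.
  apply: (@le_trans _ _ ((1 + 4 * x) * N * D)).
    rewrite ler_wpM2r ?(ltW D0)//; lra.
  have : D * (1 - x) <= e + o by nra.
  move=> H; apply: (@le_trans _ _ ((1 + 18 * x) * N * (D * (1 - x)))); last first.
    by rewrite ler_wpM2l// mulr_ge0 ?ltW//; lra.
  rewrite (_ : _ * D = (N * D) * (1 + 4 * x)); last by ring.
  rewrite (_ : _ * (D * _) = (N * D) * ((1 + 18 * x) * (1 - x))); last by ring.
  apply: ler_wpM2l; [by rewrite mulr_ge0// ltW|nra].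
apply: (@le_trans _ _ ((1 + 18 * x) * ((e - o) / (e + o)))); last first.
  rewrite ler_wpM2r// divr_ge0// ?ltW//; nra.
rewrite mulrA ler_pdivrMr// mulrAC ler_pdivlMr//.
have H : N * (1 - 5 * x) <= e - o by nra.
have xD : x <= D * x by rewrite ler_peMl.
have H2 : e + o <= D * (1 + 3 * x).
  by rewrite (_ : _ * _ = D + 3 * (D * x)); [lra|ring].
apply: (@le_trans _ _ (N * (D * (1 + 3 * x)))); first by rewrite ler_wpM2l// ltW.
apply: (@le_trans _ _ ((1 + 18 * x) * (N * (1 - 5 * x)) * D)); last first.
  by rewrite ler_wpM2r ?(ltW D0)// ler_wpM2l//; lra.
rewrite (_ : N * (D * (1 + 3 * x)) = (N * D) * (1 + 3 * x)); last by ring.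
rewrite (_ : _ * D = (N * D) * ((1 + 18 * x) * (1 - 5 * x))); last by ring.
apply: ler_wpM2l; [by rewrite mulr_ge0// ltW|nra].
Qed.

End TauProduct.

Section TauTower.
Variable R : realType.
Implicit Types s t u v y : R.

(** Iterating [tau_double] yields [2 ^ n] points of spacing [2 * s], centred at [t]. The parameter
    has grown to [2 ^+ n * s], where two-factor approximations are accurate. *)
Lemma tau_tower s t n : 0 < s ->
  tau s t = \prod_(0 <= i < 2 ^ n) tau (2 ^+ n * s) (t + ((2 * i + 1)%:R - 2 ^+ n) * s).
Proof.
move=> s0; elim: n => [|n IH].
  by rewrite big_nat1 expr0 mul1r muln0 add0n subrr mul0r addr0.
rewrite {}IH; under eq_bigr => i _.
  rewrite tau_double ?mulr_gt0 ?exprn_gt0//.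
  over.
rewrite big_split/= expnS mul2n -addnn.
rewrite [RHS](@big_cat_nat _ _ _ (2 ^ n)) ?leq_addr//=; congr (_ * _).
  apply: eq_bigr => i _; rewrite exprS -mulrA; congr tau; ring.
rewrite -{2}[(2 ^ n)%N]add0n big_addn addnK; apply: eq_bigr => i _.
rewrite exprS -mulrA; congr tau.
rewrite (natrD _ (2 * i)) (natrM _ 2 i) (natrD _ (2 * (i + 2 ^ n))) natrM natrD natrX; ring.
Qed.

(** The quotient of the factors of index [i] in Jacobi's triple products for [theta_alt] and
    [theta]. *)
Definition tau_factor s t (i : nat) : R :=
  cay (expR (t - (2 * i + 1)%:R * s)) * cay (expR (- t - (2 * i + 1)%:R * s)).

Definition tau_prod s t N := \prod_(0 <= i < N) tau_factor s t i.

Lemma cay_expR_ge0_le1 y : y <= 0 -> 0 <= cay (expR y) <= 1.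
Proof.
move=> y0; rewrite cay_le1 ?expR_ge0// cay_ge0 // expR_ge0 /=.
by rewrite -expR0 ler_expR.
Qed.

Lemma tau_factor_ge0_le1 s t i : `|t| <= s -> 0 <= tau_factor s t i <= 1.
Proof.
rewrite ler_norml => /andP[t1 t2].
have s0 : 0 <= s by lra.
have H : s <= (2 * i + 1)%:R * s by rewrite ler_peMl// ler1n addn1.
have /andP[a0 a1] : 0 <= cay (expR (t - (2 * i + 1)%:R * s)) <= 1.
  by apply: cay_expR_ge0_le1; lra.
have /andP[b0 b1] : 0 <= cay (expR (- t - (2 * i + 1)%:R * s)) <= 1.
  by apply: cay_expR_ge0_le1; lra.
by rewrite mulr_ge0//= mulr_ile1.
Qed.

Lemma tau_prod_ge0 s t N : `|t| <= s -> 0 <= tau_prod s t N.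
Proof.
by move=> ts; apply: prodr_ge0 => i _; case/andP: (tau_factor_ge0_le1 i ts).
Qed.

Lemma tau_prod_le s t M N : `|t| <= s -> (M <= N)%N ->
  tau_prod s t N <= tau_prod s t M.
Proof.
move=> ts MN; rewrite /tau_prod (@big_cat_nat _ _ _ M)//=.
rewrite ler_piMr ?(tau_prod_ge0 _ ts)//.
by apply: prodr_ile1 => i _; exact: tau_factor_ge0_le1.
Qed.

(** For [N = 2 ^ n], reversing the factors in [expR t] makes the pair of index [i] the two-factor
    approximation at the point of index [i] in [tau_tower]. *)
Lemma tau_prod_rev s t N : tau_prod s t N = \prod_(0 <= i < N)
  (cay (expR (t - (2 * (N - i.+1) + 1)%:R * s)) *
   cay (expR (- t - (2 * i + 1)%:R * s))).
Proof.
rewrite /tau_prod /tau_factor big_split/= [RHS]big_split/=; congr (_ * _).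
by rewrite big_nat_rev/= add0n.
Qed.

Lemma tau_approx_step s t (d : R) : 0 < s -> `|t| <= s ->
  expR (- s) <= 2^-1 -> 0 < d -> d <= (1 - expR (t - s)) * (1 - expR (- t - s)) ->
  18 * expR (- s) ^+ 2 <= d ->
  tau s t <= expR (18 * expR (- s) ^+ 2 / d) * (cay (expR (t - s)) * cay (expR (- t - s))) /\
  cay (expR (t - s)) * cay (expR (- t - s)) <= expR (18 * expR (- s) ^+ 2 / d) * tau s t.
Proof.
move=> s0 ts Q2 d0 dd Qd; rewrite /tau /theta_alt theta_evenDodd//.
have /andP[t1 t2] : - s <= t <= s by rewrite -ler_norml.
have u1 : expR (t - s) < 1.
  rewrite lt_neqAle -{2}expR0 ler_expR subr_le0 t2 andbT; apply/eqP => H.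
  by move: dd; rewrite H subrr mul0r leNgt d0.
have v1 : expR (- t - s) < 1.
  rewrite lt_neqAle -{2}expR0 ler_expR andbC; apply/andP; split; first by lra.
  by apply/eqP => H; move: dd; rewrite H subrr mulr0 leNgt d0.
apply: cay_approx => //; rewrite ?expR_ge0//.
- by rewrite -expRD -expRM_natl; congr expR; ring.
- exact: theta_ge1 (mulr_gt0 _ s0).
- rewrite /theta_odd.
  have := @theta_ge _ (4 * s) (2 * t - 4 * s) (mulr_gt0 (ltr0n _ 4) s0).
  rewrite -(ler_pM2l (expR_gt0 (t - s))) mulrDr mulr1 -expRD => H.
  rewrite (_ : - t - s = t - s + (- (4 * s) - (2 * t - 4 * s)))//; ring.
- by rewrite -theta_evenDodd//; exact: theta_le.
Qed.

(** In the tower with [S = 2 ^ n * s], each value of [tau S] is within a factor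
    [expR (18 * expR (- S) ^+ 2 / d)] of its two-factor approximation. The [2 ^ n] errors together
    vanish as [n] grows. *)
Lemma tau_approx s t (eps : R) : 0 < s -> `|t| < s -> 0 < eps ->
  exists N, forall n, (N <= n)%N ->
  tau s t <= expR eps * tau_prod s t (2 ^ n) /\
  tau_prod s t (2 ^ n) <= expR eps * tau s t.
Proof.
move=> s0 ts e0.
have /andP[t1 t2] : - s < t < s by rewrite -ltr_norml.
(* [r] bounds both exponentials at every point of the tower, so [(1 - r) ^+ 2] is a lower bound for
   [(1 - u) * (1 - v)] uniform in the point and in [n]. *)
pose r := expR (`|t| - s); have r1 : r < 1 by rewrite -expR0 ltr_expR subr_lt0.
have [d d0 dE] : exists2 d : R, 0 < d & d = (1 - r) ^+ 2.
  by exists ((1 - r) ^+ 2); rewrite // exprn_gt0// subr_gt0.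
(* The three entries guarantee, in this order, a total error at most [eps], the condition
   [18 * w <= d] of [cay_approx], and [expR (- S) <= 1 / 2]. *)
pose K := Num.max (18 / (s ^+ 2 * d * eps)) (Num.max (18 / (s ^+ 2 * d)) (1 / s)).
exists (Num.truncn K).+1 => n Nn.
have NK : K <= 2 ^+ n.
  apply: le_trans (ltW (truncnS_gt _)) _.
  by rewrite -natrX ler_nat (leq_trans Nn)// ltnW// ltn_expl.
move: NK; rewrite !ge_max => /and3P[K1 K2 K3].
pose M : R := 2 ^+ n; have M1 : 1 <= M by rewrite exprn_ege1// ler1n.
have M0 : 0 < M by exact: lt_le_trans M1.
pose S := M * s; have S0 : 0 < S by rewrite mulr_gt0.
have Q2 : expR (- S) <= 2^-1.
  rewrite expRN lef_pV2 ?posrE ?expR_gt0//.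
  by apply: le_trans (expR_ge1Dx _); move: K3; rewrite ler_pdivrMr// -/M -/S; lra.
have QS : expR (- S) ^+ 2 <= (S ^+ 2)^-1.
  rewrite expRN exprVn lef_pV2 ?posrE ?exprn_gt0 ?expR_gt0//.
  rewrite ler_sqr ?nnegrE ?expR_ge0 ?(ltW S0)//.
  by apply: le_trans (expR_ge1Dx _); lra.
have QM : M * expR (- S) ^+ 2 <= (s ^+ 2 * M)^-1.
  apply: le_trans (_ : M * (S ^+ 2)^-1 <= _); first by rewrite ler_wpM2l// ltW.
  rewrite le_eqVlt; apply/orP; left; apply/eqP; rewrite /S.
  by field; rewrite !gt_eqF.
have s2 : 0 < s ^+ 2 by rewrite exprn_gt0.
have Qd : 18 * expR (- S) ^+ 2 <= d.
  have : 18 * (M * expR (- S) ^+ 2) <= d.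
    apply: le_trans (_ : 18 * (s ^+ 2 * M)^-1 <= _); first by rewrite ler_wpM2l.
    rewrite ler_pdivrMr ?mulr_gt0//; move: K2; rewrite ler_pdivrMr ?mulr_gt0// -/M.
    by rewrite (_ : M * _ = d * (s ^+ 2 * M))//; ring.
  by apply: le_trans; rewrite ler_wpM2l// ler_peMl ?sqr_ge0.
have Qe : (18 * expR (- S) ^+ 2 / d) *+ 2 ^ n <= eps.
  rewrite -mulr_natr natrX -/M (_ : _ * M = 18 * (M * expR (- S) ^+ 2) / d).
    rewrite ler_pdivrMr// (@le_trans _ _ (18 * (s ^+ 2 * M)^-1)) ?ler_wpM2l//.
    rewrite ler_pdivrMr ?mulr_gt0//.
    move: K1; rewrite ler_pdivrMr ?mulr_gt0// -/M.
    by rewrite (_ : M * _ = eps * d * (s ^+ 2 * M))//; ring.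
  by ring.
pose T i := t + ((2 * i + 1)%:R - M) * s.
have Tb i : (i < 2 ^ n)%N -> `|T i| <= S /\
   (d <= (1 - expR (T i - S)) * (1 - expR (- T i - S))).
  move=> iM; have iM' : i%:R + 1 <= M by rewrite /M -natrX natr1 ler_nat.
  have i0 : 0 <= i%:R * s by rewrite mulr_ge0// ltW.
  have iS : i%:R * s + s <= S by rewrite -{2}[s]mul1r -mulrDl ler_wpM2r// ltW.
  have TE : T i = t + 2 * (i%:R * s) + s - S.
    by rewrite /T /S natrD natrM; ring.
  have tt : `|t| < s by [].
  have := ler_norm t; have := ler_norm (- t); rewrite normrN => n1 n2.
  split; first by rewrite ler_norml; apply/andP; split; rewrite TE; lra.
  rewrite dE expr2 ler_pM ?subr_ge0 ?(ltW r1)// lerD2l lerN2 ler_expR TE; lra.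
have fac i : (i < 2 ^ n)%N -> tau S (T i) <= expR (18 * expR (- S) ^+ 2 / d) *
      (cay (expR (T i - S)) * cay (expR (- T i - S))) /\
    cay (expR (T i - S)) * cay (expR (- T i - S)) <=
      expR (18 * expR (- S) ^+ 2 / d) * tau S (T i).
  by move=> /Tb[b1 b2]; apply: tau_approx_step.
have pE : tau_prod s t (2 ^ n) =
    \prod_(0 <= i < 2 ^ n) (cay (expR (T i - S)) * cay (expR (- T i - S))).
  rewrite tau_prod_rev big_nat [RHS]big_nat; apply: eq_bigr => i /andP[_ iM].
  congr (cay (expR _) * cay (expR _)); rewrite /T /S; last by ring.
  rewrite natrD natrM natrB// natrX -/M -natr1 natrD natrM; ring.
have EE : expR (18 * expR (- S) ^+ 2 / d) ^+ (2 ^ n) <= expR eps.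
  by rewrite -expRM_natl ler_expR mulr_natl.
have tE : tau s t = \prod_(0 <= i < 2 ^ n) tau S (T i) by exact: tau_tower.
have cay0 i : (i < 2 ^ n)%N -> 0 <= cay (expR (T i - S)) * cay (expR (- T i - S)).
  move=> /Tb[+ _]; rewrite ler_norml => /andP[b1 b2].
  have /cay_expR_ge0_le1/andP[c1 _] : T i - S <= 0 by rewrite subr_le0.
  have /cay_expR_ge0_le1/andP[c2 _] : - T i - S <= 0 by rewrite subr_le0 lerNl.
  exact: mulr_ge0.
have tau0 i : (i < 2 ^ n)%N -> 0 <= tau S (T i).
  move=> iM; have := le_trans (cay0 i iM) (fac i iM).2.
  by rewrite pmulr_rge0 ?expR_gt0.
have PE (f : nat -> R) : \prod_(0 <= i < 2 ^ n) (expR (18 * expR (- S) ^+ 2 / d) * f i)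
   = expR (18 * expR (- S) ^+ 2 / d) ^+ (2 ^ n) * \prod_(0 <= i < 2 ^ n) f i.
  by rewrite big_split/= prodr_const_nat subn0.
rewrite tE pE; split.
  apply: le_trans (_ : expR (18 * expR (- S) ^+ 2 / d) ^+ (2 ^ n) *
     \prod_(0 <= i < 2 ^ n) (cay (expR (T i - S)) * cay (expR (- T i - S))) <= _).
    rewrite -PE big_nat [leRHS]big_nat; apply: ler_prod => i /andP[_ iM].
    by rewrite tau0// (fac i iM).1.
  rewrite ler_wpM2r// big_nat; apply: prodr_ge0 => i /andP[_ iM]; exact: cay0.
apply: le_trans (_ : expR (18 * expR (- S) ^+ 2 / d) ^+ (2 ^ n) *
     \prod_(0 <= i < 2 ^ n) tau S (T i) <= _).
  rewrite -PE big_nat [leRHS]big_nat; apply: ler_prod => i /andP[_ iM].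
  by rewrite cay0// (fac i iM).2.
rewrite ler_wpM2r// big_nat; apply: prodr_ge0 => i /andP[_ iM]; exact: tau0.
Qed.

Lemma ler_expR_eps (x y : R) : 0 <= y ->
  (forall eps, 0 < eps -> x <= expR eps * y) -> x <= y.
Proof.
move=> y0 H; have [y00|yN] := eqVneq y 0.
  by have := H 1 ltr01; rewrite y00 mulr0.
have {}y0 : 0 < y by rewrite lt_neqAle eq_sym yN.
rewrite leNgt; apply/negP => yx.
have xy : 1 < x / y by rewrite ltr_pdivlMr// mul1r.
have l0 : 0 < ln (x / y) by rewrite ln_gt0.
have := H (ln (x / y) / 2) ltac:(by rewrite divr_gt0).
rewrite -ler_pdivrMr// -{1}[x / y]lnK ?posrE ?(lt_trans ltr01)// ler_expR; lra.
Qed.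

(** The partial products decrease in [N], and those of length [2 ^ n] approximate [tau s t]. *)
Lemma tau_le_prod s t N : 0 < s -> `|t| < s -> tau s t <= tau_prod s t N.
Proof.
move=> s0 ts; apply: ler_expR_eps => [|eps e0].
  by rewrite tau_prod_ge0// ltW.
have [n0 Hn] := tau_approx s0 ts e0.
have [H _] := Hn (maxn n0 N) (leq_maxl _ _).
apply: le_trans H _; rewrite ler_wpM2l ?expR_ge0// tau_prod_le ?(ltW ts)//.
by rewrite (leq_trans (leq_maxr n0 N))// ltnW// ltn_expl.
Qed.

Lemma tau_ge0 s t : 0 < s -> `|t| < s -> 0 <= tau s t.
Proof.
move=> s0 ts; have [n0 Hn] := tau_approx s0 ts ltr01.
have [_ H] := Hn n0 (leqnn _).
have := le_trans (tau_prod_ge0 _ (ltW ts)) H.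
by rewrite pmulr_rge0 ?expR_gt0.
Qed.

(** Induction on [N]: each new block of [L] factors gives one [cay] in [expR t] and one in
    [expR (- t)] to every product on the right, the former matched in reverse order. *)
Lemma tau_prod_mul s t L N : (0 < L)%N -> tau_prod s t (N * L) =
  \prod_(0 <= i < L) tau_prod (L%:R * s) (t + ((2 * i + 1)%:R - L%:R) * s) N.
Proof.
move=> L0; elim: N => [|N IH].
  by rewrite mul0n /tau_prod big_nil big1// => i _; rewrite big_nil.
under eq_bigr => i _ do rewrite {1}/tau_prod big_nat_recr//= -/(tau_prod _ _ _).
rewrite big_split/= -IH mulSn addnC /tau_prod (@big_cat_nat _ _ _ (N * L)) ?leq_addr//=.
congr (_ * _); rewrite -{1}[(N * L)%N]add0n big_addn addnC addnK /tau_factor.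
rewrite big_split/= [RHS]big_split/=.
rewrite [X in X * _ = _]big_nat_rev/= add0n; congr (_ * _).
  rewrite big_nat [RHS]big_nat; apply: eq_bigr => i /andP[_ iL].
  congr (cay (expR _)); set k := (L - i.+1)%N.
  have LE : L%:R = k%:R + i%:R + 1 :> R by rewrite -addrA natr1 -natrD subnK.
  by rewrite (natrD _ (2 * _)) (natrM _ 2) (natrD _ k) (natrM _ N L) LE; ring.
by apply: eq_bigr => i _; congr (cay (expR _)); ring.
Qed.

(* Both sides are the same infinite product. *)
Lemma prod_tau_le s t L : (0 < L)%N -> 0 < s -> `|t| < s ->
  \prod_(0 <= i < L) tau (L%:R * s) (t + ((2 * i + 1)%:R - L%:R) * s) <= tau s t.
Proof.
move=> L0 s0 ts; apply: ler_expR_eps => [|eps e0]; first exact: tau_ge0.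
have [n Hn] := tau_approx s0 ts e0.
have [_ H] := Hn n (leqnn _).
apply: le_trans H; apply: le_trans (tau_prod_le (M := 2 ^ n) (N := 2 ^ n * L) (ltW ts) _).
  rewrite tau_prod_mul// big_nat [leRHS]big_nat; apply: ler_prod => i /andP[_ iL].
  have L0' : 0 < L%:R * s by rewrite mulr_gt0// ltr0n.
  have tL : `|t + ((2 * i + 1)%:R - L%:R) * s| < L%:R * s.
    have iL' : i%:R + 1 <= L%:R :> R by rewrite natr1 ler_nat.
    have i0 : 0 <= i%:R * s by rewrite mulr_ge0// ltW.
    have iS : i%:R * s + s <= L%:R * s by rewrite -{2}[s]mul1r -mulrDl ler_wpM2r// ltW.
    rewrite (_ : _ + _ = t + 2 * (i%:R * s) + s - L%:R * s); last first.
      by rewrite natrD natrM; ring.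
    have := ler_norm t; have := ler_norm (- t); rewrite normrN => n1 n2.
    by rewrite ltr_norml; apply/andP; split; lra.
  by rewrite tau_ge0// tau_le_prod.
by rewrite leq_pmulr.
Qed.

End TauTower.

(** * Smallness of the quotient at the origin *)

Section OddBasel.
Variable R : realType.
Implicit Types x y s : R.

Lemma ger0_is_derive_le (f df : R -> R) a b : a <= b ->
  (forall x, a <= x <= b -> is_derive x 1 f (df x)) ->
  (forall x, a <= x <= b -> 0 <= df x) -> f a <= f b.
Proof.
move=> ab fdf df0.
have [x||c] := MVT_segment ab (f := f) (df := df).
- by rewrite in_itv/= => /andP[/ltW ax /ltW xb]; apply: fdf; rewrite ax.
- apply: derivable_within_continuous => x; rewrite in_itv/= => /fdf H.
  exact: ex_derive.
- rewrite in_itv/= => /df0 dc E; rewrite -subr_ge0 E mulr_ge0// subr_ge0 //.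
Qed.

Lemma mul_cos_le_sin x : 0 <= x <= pi -> x * cos x <= sin x.
Proof.
move=> /andP[x0 xpi]; rewrite -subr_ge0.
pose g (y : R) : R := sin y - y * cos y.
rewrite (_ : 0 = g 0); last by rewrite /g sin0 mul0r subrr.
apply: (@ger0_is_derive_le g (fun y => y * sin y)) => // y /andP[y0 yx].
  have H := is_deriveB (is_derive_sin y) (is_deriveM (is_derive_id y 1) (is_derive_cos y)).
  by apply: is_derive_eq H _; rewrite /GRing.scale/=; ring.
by rewrite mulr_ge0// sin_ge0_pi// y0 (le_trans yx).
Qed.

(** Equivalent to [cot x <= 1 / x], that is to [mul_cos_le_sin]. *)
Lemma inv_sin2_le x : 0 < x < pi / 2 -> (sin x ^+ 2)^-1 <= 1 + (x ^+ 2)^-1.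
Proof.
move=> /andP[x0 x2]; have s0 : 0 < sin x by rewrite sin_gt0_pihalf// x0.
have p2 : 0 < pi / 2 :> R by rewrite divr_gt0// pi_gt0.
have H : x * cos x <= sin x by apply: mul_cos_le_sin; rewrite ltW//=; lra.
have c0 : 0 < cos x by rewrite cos_gt0_pihalf// x2 andbT (lt_trans _ x0)// oppr_lt0.
have x20 : 0 < x ^+ 2 by rewrite exprn_gt0.
have s20 : 0 < sin x ^+ 2 by rewrite exprn_gt0.
rewrite (_ : (sin x ^+ 2)^-1 = 1 + cos x ^+ 2 / sin x ^+ 2); last first.
  by rewrite cos2sin2; field; rewrite gt_eqF.
rewrite lerD2l ler_pdivrMr// mulrC ler_pdivlMr// -exprMn.
by rewrite ler_sqr ?nnegrE ?(ltW s0)// mulrC// mulr_ge0// ltW.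
Qed.

(** Halving the angles, the indices [k] and [2 ^ n.+1 - 1 - k] carry complementary angles [x / 2]
    and [pi / 2 - x / 2]; their inverse squares of sines add up to [4 / sin x ^+ 2]. *)
Lemma sum_inv_sin2 n :
  \sum_(0 <= k < 2 ^ n) (sin ((2 * k + 1)%:R * pi / (4 * 2 ^+ n)) ^+ 2)^-1 =
  2 * 4 ^+ n :> R.
Proof.
have pi0 := pi_gt0 R.
elim: n => [|n IH].
  rewrite big_nat1 muln0 add0n mul1r !expr0 !mulr1.
  have : sin (pi / 4 *+ 2) = 1 :> R by rewrite -[RHS]sin_pihalf; congr sin; field.
  have : cos (pi / 4 *+ 2) = 0 :> R by rewrite -[RHS]cos_pihalf; congr cos; field.
  rewrite cos_mulr2n cos2sin2 => H _.
  by rewrite (_ : sin (pi / 4) ^+ 2 = 2^-1) ?invrK//; lra.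
rewrite [in RHS]exprS [in RHS]mulrCA -{}IH mulr_sumr expnS mul2n -addnn.
rewrite (@big_cat_nat _ _ _ (2 ^ n)) ?leq_addr//=.
rewrite -{2}[(2 ^ n)%N]add0n big_addn addnK.
rewrite [X in _ + X = _]big_nat_rev/= add0n -big_split/=.
rewrite big_nat [RHS]big_nat; apply: eq_bigr => k /andP[_ kn].
set x : R := _ * pi / (4 * 2 ^+ n).
have M0 : 0 < 2 ^+ n :> R by rewrite exprn_gt0.
rewrite (_ : _ * pi / (4 * 2 ^+ n.+1) = x / 2); last first.
  by rewrite /x exprS; field; rewrite gt_eqF.
rewrite (_ : _ * pi / (4 * 2 ^+ n.+1) = pi / 2 - x / 2); last first.
  set j := (2 ^ n - k.+1)%N.
  have jE : 2 ^+ n = j%:R + k%:R + 1 :> R.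
    by rewrite -addrA natr1 -natrD subnK// natrX.
  rewrite /x exprS natrD (natrM _ 2) (natrD _ j) natrX jE; field.
  by rewrite -jE gt_eqF.
rewrite sinB sin_pihalf cos_pihalf mul1r mul0r subr0.
have x0 : 0 < x / 2 by rewrite !mulr_gt0 ?invr_gt0 ?mulr_gt0// ltr0n addn1.
have x1 : x / 2 < pi / 2.
  rewrite ltr_pM2r ?invr_gt0// /x ltr_pdivrMr ?mulr_gt0// mulrC ltr_pM2l//.
  rewrite -natrX -natrM ltr_nat; lia.
have s0 : 0 < sin (x / 2) by rewrite sin_gt0_pihalf// x0.
have c0 : 0 < cos (x / 2).
  by rewrite cos_gt0_pihalf// x1 andbT (lt_trans _ x0)// oppr_lt0 divr_gt0.
rewrite (_ : sin x = 2 * sin (x / 2) * cos (x / 2)); last first.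
  by rewrite {1}(_ : x = (x / 2) *+ 2) ?sin_mulr2n; [ring|field].
have := cos2Dsin2 (x / 2); move: (sin _) (cos _) s0 c0 => a b a0 b0 ab.
rewrite (_ : (a ^+ 2)^-1 + (b ^+ 2)^-1 = (b ^+ 2 + a ^+ 2) / (a ^+ 2 * b ^+ 2)).
  by rewrite ab; field; rewrite !gt_eqF.
by field; rewrite !gt_eqF.
Qed.

(** A finite form of the value [pi ^+ 2 / 8] of the full series: bound each term of [sum_inv_sin2]
    by [inv_sin2_le] and solve for the sum. *)
Lemma sum_inv_odd2_ge n : pi ^+ 2 / 8 * (1 - (2 ^+ n)^-1) <=
  \sum_(0 <= k < 2 ^ n) ((2 * k + 1)%:R ^+ 2)^-1 :> R.
Proof.
have pi0 := pi_gt0 R.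
have M0 : 0 < 2 ^+ n :> R by rewrite exprn_gt0.
have H : 2 * 4 ^+ n <= 2 ^+ n + 16 * 4 ^+ n / pi ^+ 2 *
    \sum_(0 <= k < 2 ^ n) ((2 * k + 1)%:R ^+ 2)^-1 :> R.
  rewrite -sum_inv_sin2 mulr_sumr.
  rewrite (_ : 2 ^+ n + _ = \sum_(0 <= k < 2 ^ n) 1 +
      \sum_(0 <= k < 2 ^ n) 16 * 4 ^+ n / pi ^+ 2 * ((2 * k + 1)%:R ^+ 2)^-1); last first.
    by rewrite sumr_const_nat subn0 natrX.
  rewrite -big_split/= big_nat [leRHS]big_nat; apply: ler_sum => k /andP[_ kn].
  have k0 : 0 < (2 * k + 1)%:R :> R by rewrite ltr0n addn1.
  apply: le_trans (inv_sin2_le _) _; last first.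
    rewrite lerD2l le_eqVlt; apply/orP; left; apply/eqP.
    rewrite (_ : 4 ^+ n = (2 ^+ n) ^+ 2 :> R); last first.
      by rewrite -exprM mulnC exprM; congr (_ ^+ _); ring.
    by move: pi pi0 ((2 * k + 1)%:R) k0 => p p0 K k0; field; rewrite !gt_eqF.
  rewrite divr_gt0 ?mulr_gt0//= ltr_pdivrMr ?mulr_gt0// mulrC.
  rewrite (_ : pi / 2 * (4 * 2 ^+ n) = pi * (2 * 2 ^+ n)); last by field.
  rewrite ltr_pM2l// -natrX -natrM ltr_nat; lia.
have M1 : 1 <= 2 ^+ n :> R by rewrite exprn_ege1// ler1n.
move: H; rewrite (_ : 4 ^+ n = (2 ^+ n) ^+ 2 :> R); last first.
  by rewrite -exprM mulnC exprM; congr (_ ^+ _); ring.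
move: (2 ^+ n) (\sum_(_ <= _ < _) _) M0 M1 => M S M0 M1 H.
rewrite -(ler_pM2l (_ : 0 < 16 * M ^+ 2 / pi ^+ 2)); last first.
  by rewrite divr_gt0 ?mulr_gt0 ?exprn_gt0.
move: H; rewrite -lerBlDl => /(le_trans _); apply.
rewrite [leLHS](_ : _ = 2 * M ^+ 2 - 2 * M); first by lra.
by move: pi pi0 => p p0; field; rewrite !gt_eqF.
Qed.

(** The sum is a truncation of the series of [artanh y], whose terms are non-negative. *)
Lemma cay_le_expR J y : 0 <= y < 1 ->
  cay y <= expR (- (2 * \sum_(0 <= j < J) y ^+ (2 * j + 1) / (2 * j + 1)%:R)).
Proof.
move=> /andP[y0 y1].
pose S z : R := \sum_(0 <= j < J) z ^+ (2 * j + 1) / (2 * j + 1)%:R.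
pose dS z : R := \sum_(0 <= j < J) z ^+ (2 * j).
have SdS (z : R) : is_derive z 1 S (dS z).
  rewrite /S /dS; elim: J {S dS} => [|J IH].
    rewrite big_nil; apply: is_derive_eq; last exact: erefl.
    rewrite (_ : (fun _ => _) = cst 0); first exact: is_derive_cst.
    by apply/funext => x; rewrite big_nil.
  have H := is_deriveD IH (is_deriveZ ((2 * J + 1)%:R^-1)
    (is_deriveX (2 * J + 1) (is_derive_id z 1))).
  rewrite (_ : (fun _ => _) = (fun z => \sum_(0 <= j < J) z ^+ (2 * j + 1) / (2 * j + 1)%:R) +
      ((2 * J + 1)%:R^-1 \*: (id ^+ (2 * J + 1)))); last first.
    apply/funext => x; rewrite big_nat_recr//=; congr (_ + _).
    by rewrite /= exprfctE mulrC.
  apply: is_derive_eq H _; rewrite big_nat_recr//=; congr (_ + _).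
  by rewrite /GRing.scale/= mulr1 addn1 /= mulrA mulVf ?mul1r.
pose L z : R := ln (1 + z) - ln (1 - z) - 2 * S z.
have L0 : L 0 = 0.
  rewrite /L /S addr0 subr0 subrr big1 ?mulr0 ?subrr// => j _.
  by rewrite addn1 expr0n /= mul0r.
have Ly : L 0 <= L y.
  apply: (@ger0_is_derive_le L (fun z => (1 + z)^-1 + (1 - z)^-1 - 2 * dS z)) => // z /andP[z0 zy].
    have h1 : is_derive z (1 : R) (@ln R \o (fun z : R => 1 + z)) ((1 + z)^-1 * 1).
      apply: is_derive1_comp; first by apply: is_derive1_ln; lra.
      by have := is_deriveD (is_derive_cst (1 : R) z (1 : R)) (is_derive_id z (1 : R)); rewrite add0r.
    have h2 : is_derive z (1 : R) (@ln R \o (fun z : R => 1 - z)) ((1 - z)^-1 * - 1).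
      apply: is_derive1_comp; first by apply: is_derive1_ln; lra.
      by have := is_deriveB (is_derive_cst (1 : R) z (1 : R)) (is_derive_id z (1 : R)); rewrite sub0r.
    have H := is_deriveB (is_deriveB h1 h2) (is_deriveZ 2 (SdS z)).
    by apply: is_derive_eq H _; rewrite /GRing.scale/=; ring.
  (* Multiplied by [1 - z ^+ 2], the derivative of [L] becomes [2 * z ^+ (2 * J)]. *)
  have z2 : 0 < 1 - z ^+ 2 by nra.
  have E : (1 - z ^+ 2) * dS z = 1 - z ^+ (2 * J).
    rewrite /dS big_mkord -opprB mulNr; under eq_bigr do rewrite exprM.
    by rewrite -subrX1 opprB exprM.
  rewrite -(pmulr_rge0 _ z2) mulrBr (mulrCA _ 2) E.
  rewrite (_ : _ * (_ + _) = 2); last by field; rewrite !gt_eqF//; lra.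
  by have := exprn_ge0 (2 * J) z0; lra.
move: Ly; rewrite L0 /L subr_ge0 -/(S y) => H.
rewrite /cay -[leLHS]lnK ?posrE ?divr_gt0; try lra.
by rewrite ler_expR ln_div ?posrE; lra.
Qed.

End OddBasel.

Section TauZero.
Variable R : realType.
Implicit Types x y s : R.

(** In terms of [tau / 2], [tau_landen] says that squaring the value at [2 * s] stays below the
    value at [s], which iterates without a constant. *)
Lemma tau0_half_pow s n : 0 < s ->
  (tau (2 ^+ n * s) 0 / 2) ^+ (2 ^ n) <= tau s 0 / 2.
Proof.
move=> s0; elim: n => [|n IH]; first by rewrite !expr0 mul1r expr1.
have S0 : 0 < 2 ^+ n * s by rewrite mulr_gt0 ?exprn_gt0.
apply: le_trans IH; rewrite exprS -mulrA expnS exprM.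
apply: lerXn2r; rewrite ?nnegrE ?sqr_ge0 ?(divr_ge0 (tau0_ge0 S0))//.
by rewrite expr_div_n; have := tau_landen S0; lra.
Qed.

Lemma sum_expR_odd_ge x N : 0 < x -> (0 < N)%N ->
  expR (- x) * (1 - (2 * N%:R * x)^-1) / (2 * x) <=
  \sum_(0 <= i < N) expR (- ((2 * i + 1)%:R * x)).
Proof.
move=> x0 N0; have N0' : 0 < N%:R :> R by rewrite ltr0n.
pose w := expR (- (2 * x)).
have w1 : w < 1 by rewrite -expR0 ltr_expR oppr_lt0 mulr_gt0.
have -> : \sum_(0 <= i < N) expR (- ((2 * i + 1)%:R * x)) =
    expR (- x) * (1 - w ^+ N) / (1 - w).
  apply: (canRL (mulfK _)); first by rewrite subr_eq0 gt_eqF.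
  rewrite -opprB -[in RHS]opprB subrX1 !mulrN (mulrCA _ (w - 1)) mulrC.
  congr (- (_ * _)); rewrite big_mkord mulr_sumr; apply: eq_bigr => i _.
  by rewrite -expRM_natl -expRD; congr expR; rewrite natrD natrM; ring.
have wN : w ^+ N <= (2 * N%:R * x)^-1.
  rewrite -expRM_natl mulrN expRN lef_pV2 ?posrE ?expR_gt0 ?mulr_gt0//.
  by apply: le_trans (expR_ge1Dx _); rewrite mulrCA mulrA; lra.
have w2 : 1 - w <= 2 * x by have := expR_ge1Dx (- (2 * x)); rewrite -/w; lra.
have wN1 : 0 <= 1 - w ^+ N by rewrite subr_ge0 exprn_ile1 ?expR_ge0// ltW.
apply: le_trans (_ : expR (- x) * (1 - w ^+ N) / (2 * x) <= _).
  rewrite ler_wpM2r ?invr_ge0 ?mulr_ge0 ?(ltW x0)//.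
  by rewrite ler_pM2l ?expR_gt0 ?lerD2l ?lerN2.
rewrite ler_wpM2l ?mulr_ge0 ?expR_ge0// lef_pV2 ?posrE ?mulr_gt0//.
by rewrite subr_gt0.
Qed.

(** Bound the factors of the product for [tau s 0] by truncated [artanh] series and exchange the
    sums. The geometric sum over [i] is about [1 / (2 (2 j + 1) s)], which produces the inverse odd
    squares. *)
Lemma tau0_le_sum s J : 0 < s -> (0 < J)%N -> 3 * J%:R * s <= 1 ->
  tau s 0 <= expR (- (2 / s * ((1 - 3 * J%:R * s) *
    \sum_(0 <= j < J) ((2 * j + 1)%:R ^+ 2)^-1))).
Proof.
move=> s0 J0 Js; have J1 : 1 <= J%:R :> R by rewrite ler1n.
(* Enough factors for the truncation error [(2 * N * x)^-1] of every geometric sum to be at most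
   [s]. *)
pose N := (Num.truncn (2 * s * s)^-1).+1.
have NB : (2 * s * s)^-1 <= N%:R by exact: ltW (truncnS_gt _).
have N0 : 0 < N%:R :> R by rewrite ltr0n.
have ts : `|0 : R| < s by rewrite normr0.
apply: le_trans (tau_le_prod N s0 ts) _.
pose E i : R := 2 * \sum_(0 <= j < J) expR (- ((2 * i + 1)%:R * s)) ^+ (2 * j + 1) / (2 * j + 1)%:R.
have fac i : tau_factor s 0 i <= expR (- (2 * E i)).
  have yb : 0 <= expR (- ((2 * i + 1)%:R * s)) < 1.
    by rewrite expR_ge0 /= -expR0 ltr_expR oppr_lt0 mulr_gt0// ltr0n addn1.
  have := cay_le_expR J yb; rewrite -/(E i) /tau_factor oppr0 add0r => H.
  rewrite (_ : - (2 * E i) = - E i + - E i); last by ring.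
  by rewrite expRD ler_pM// cay_ge0//; case/andP: yb => -> /ltW.
apply: le_trans (_ : \prod_(0 <= i < N) expR (- (2 * E i)) <= _).
  by apply: ler_prod => i _; rewrite fac; case/andP: (tau_factor_ge0_le1 i (ltW ts)) => ->.
rewrite -expR_sum ler_expR sumrN lerN2 /E.
rewrite -mulr_sumr -mulr_sumr exchange_big/=.
rewrite (_ : 2 / s * _ = 2 * (2 * \sum_(0 <= j < J)
   ((1 - 3 * J%:R * s) / (2 * s) * ((2 * j + 1)%:R ^+ 2)^-1))); last first.
  by rewrite -mulr_sumr; field; rewrite gt_eqF.
rewrite !ler_pM2l// [leLHS]big_nat [leRHS]big_nat; apply: ler_sum => j /andP[_ jJ].
rewrite -mulr_suml.
have j0 : 0 < (2 * j + 1)%:R :> R by rewrite ltr0n addn1.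
pose x : R := (2 * j + 1)%:R * s; have x0 : 0 < x by rewrite mulr_gt0.
under eq_bigr => i _.
  rewrite -expRM_natl mulrN mulrCA -/x; over.
have k0 : 0 <= ((2 * j + 1)%:R : R)^-1 by rewrite invr_ge0.
apply: le_trans (ler_wpM2r k0 (@sum_expR_odd_ge x N x0 isT)).
rewrite (_ : _ * _ / (2 * x) / _ = expR (- x) * (1 - (2 * N%:R * x)^-1) / (2 * s) * ((2 * j + 1)%:R ^+ 2)^-1); last first.
  rewrite -!mulrA; congr (_ * (_ * _)); rewrite /x.
  by move: ((2 * j + 1)%:R) j0 => k' k'0; field; rewrite !gt_eqF.
rewrite ler_pM2r ?invr_gt0 ?exprn_gt0// ler_pM2r ?invr_gt0 ?mulr_gt0//.
have xJ : x <= 2 * J%:R * s.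
  by rewrite ler_pM2r// -natrM ler_nat; lia.
have sx : s <= x by rewrite ler_peMl ?(ltW s0)// ler1n addn1.
have e1 : 1 - 2 * J%:R * s <= expR (- x) by have := expR_ge1Dx (- x); lra.
have e2 : (2 * N%:R * x)^-1 <= s.
  move: NB; rewrite -[leLHS]mul1r ler_pdivrMr ?mulr_gt0// => NB.
  rewrite -[leLHS]mul1r ler_pdivrMr ?mulr_gt0//; apply: le_trans NB _.
  rewrite (_ : N%:R * _ = s * (2 * N%:R * s)); last by ring.
  by rewrite ler_pM2l// ler_pM2l ?mulr_gt0.
apply: (@le_trans _ _ ((1 - 2 * J%:R * s) * (1 - s))).
  have : 0 <= (2 * J%:R * s) * s by rewrite !mulr_ge0// (ltW s0).
  have : s <= J%:R * s by rewrite ler_peMl// (ltW s0).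
  by move: (J%:R) => j'; lra.
have sJ : s <= J%:R * s by rewrite ler_peMl// (ltW s0).
by apply: ler_pM; lra.
Qed.

(** Apply [tau0_le_sum] at [S = s / 4 ^ m] with [J = 2 ^ m], and return to [s] by [tau0_half_pow]:
    the [4 ^ m]-th root turns [pi ^+ 2 / (4 * S)] into [pi ^+ 2 / (4 * s)]. *)
Lemma tau0_le s : 0 < s -> tau s 0 <= 2 * expR (- (pi ^+ 2 / (4 * s))).
Proof.
move=> s0; have pi0 := pi_gt0 R.
have C0 : 0 < pi ^+ 2 / (4 * s) by rewrite divr_gt0 ?exprn_gt0 ?mulr_gt0.
rewrite mulrC -ler_pdivrMr//.
apply: ler_expR_eps => [|eps e0]; first exact: expR_ge0.
(* The first entry gives [3 * J * S <= 1]; the second makes the loss in the exponent at most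
   [eps]. *)
pose K := Num.max (3 * s) (pi ^+ 2 / (4 * s) * (3 * s + 1) / eps).
pose m := (Num.truncn K).+1; pose M : R := 2 ^+ m.
have M0 : 0 < M by rewrite exprn_gt0.
have : K <= M.
  apply: le_trans (ltW (truncnS_gt _)) _.
  by rewrite /M -natrX ler_nat ltnW// ltn_expl.
rewrite ge_max => /andP[KM]; rewrite ler_pdivrMr// => KM2.
pose S := s / (M * M).
have MM0 : 0 < M * M by rewrite mulr_gt0.
have S0 : 0 < S by rewrite divr_gt0.
have sS : s = 2 ^+ (m + m) * S by rewrite exprD -/M mulrC divfK// gt_eqF.
have JS : 3 * (2 ^ m)%:R * S <= 1.
  rewrite natrX -/M (_ : _ * S = 3 * s / M); last by rewrite /S; field; rewrite gt_eqF.
  by rewrite ler_pdivrMr ?mul1r.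
have H1 := tau0_le_sum S0 (expn_gt0 2 m) JS.
have H2 := tau0_half_pow (m + m) S0; rewrite -sS in H2.
rewrite -(@ler_pXn2r _ (2 ^ (m + m))) ?expn_gt0 ?nnegrE ?(divr_ge0 (tau0_ge0 s0)) ?mulr_ge0 ?expR_ge0//.
apply: le_trans H2 _.
apply: (@le_trans _ _ (tau S 0)); first by have := tau0_ge0 S0; lra.
apply: le_trans H1 _.
rewrite -expRD -expRM_natl ler_expR !natrX exprD -/M.
have B := sum_inv_odd2_ge R m; rewrite -/M in B.
rewrite natrX -/M in JS.
apply: (@le_trans _ _ (- (2 / S * ((1 - 3 * M * S) * (pi ^+ 2 / 8 * (1 - M^-1)))))).
  rewrite lerN2 ler_pM2l ?divr_gt0// ler_wpM2l// subr_ge0//.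
rewrite (_ : - (2 / S * _) = M * M * (- (pi ^+ 2 / (4 * s) * ((1 - 3 * s / M) * (1 - M^-1))))); last first.
  by rewrite /S; move: (M) M0 (pi ^+ 2) => M' M'0 p; field; rewrite !gt_eqF.
rewrite ler_pM2l//.
have : pi ^+ 2 / (4 * s) * ((3 * s + 1) / M) <= eps.
  by rewrite mulrA ler_pdivrMr// [leRHS]mulrC.
set c := pi ^+ 2 / (4 * s) in C0 *.
have : 0 <= c * (3 * s / M * M^-1) by rewrite !(mulr_ge0, invr_ge0)// ltW.
rewrite -[3 * s / M]mulrA => h1 h2.
have -> : - (c * ((1 - 3 * (s / M)) * (1 - M^-1))) =
  - c + c * ((3 * s + 1) / M) - c * (3 * (s / M) * M^-1) by ring.
lra.
Qed.

End TauZero.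

(** * Zolotarev nodes and the Cauchy kernel *)

Section Zolotarev.
Variable R : realType.
Implicit Types s t v w y : R.

Lemma tau_self s : 0 < s -> tau s s = 0.
Proof.
move=> s0; have := tau_shift s s0.
by rewrite (_ : s - 2 * s = - s) ?tauN//; [lra|ring].
Qed.

Lemma tau_abs_le1 s t : 0 < s -> `|tau s t| <= 1.
Proof.
move=> s0; apply: le_trans (tau_abs_le0 t s0) _.
have := @tau_le_prod _ s 0 0 s0; rewrite /tau_prod big_nil; apply.
by rewrite normr0.
Qed.

(** Linear vanishing at the zero [- s], from which the continuity of [zol] follows. By antisymmetry
    about [- s] take [h >= 0]; the first factor of the product is then at most
    [1 - expR (- h) <= h]. *)
Lemma tau_near s h : 0 < s -> `|h| < 2 * s -> `|tau s (h - s)| <= `|h|.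
Proof.
move=> s0; wlog h0 : h / 0 <= h => [H hs|].
  have [/H|h0] := leP 0 h; first exact.
  have := H (- h); rewrite normrN oppr_ge0 (ltW h0) => /(_ isT hs).
  rewrite (_ : - h - s = - (h - s) - 2 * s); last by ring.
  by rewrite tau_shift// normrN tauN.
rewrite (ger0_norm h0) => hs.
have [->|hn0] := eqVneq h 0; first by rewrite sub0r tauN// tau_self// normr0.
have {}h0 : 0 < h by rewrite lt_neqAle eq_sym hn0.
have ts : `|h - s| < s by rewrite ltr_norml; apply/andP; split; lra.
rewrite ger0_norm ?tau_ge0//.
apply: le_trans (tau_le_prod 1 s0 ts) _; rewrite /tau_prod big_nat1 /tau_factor.
rewrite muln0 add0n mul1r.
have c1 : cay (expR (h - s - s)) <= 1 by rewrite cay_le1// expR_ge0.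
have /andP[c2 _] : 0 <= cay (expR (- (h - s) - s)) <= 1.
  by apply: cay_expR_ge0_le1; lra.
apply: le_trans (_ : cay (expR (- (h - s) - s)) <= _).
  by rewrite ler_piMl.
rewrite (_ : - (h - s) - s = - h); last by ring.
have := expR_ge1Dx (- h); have := expR_gt0 (- h) => e0 e1.
apply: le_trans (_ : 1 - expR (- h) <= _); last by lra.
rewrite ler_pdivrMr ?ler_peMr; try lra.
by rewrite subr_ge0 -expR0 ler_expR; lra.
Qed.

Lemma zol_lip s v w : 0 < s -> `|v - w| < 2 * s ->
  `|zol s w - zol s v| <= 2 * zol s 0 * `|v - w|.
Proof.
move=> s0 vw; have zv := zol_gt0 v s0; have zw := zol_gt0 w s0.
have z0 : 0 < zol s w + zol s v by rewrite addr_gt0.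
have := zol_tau v w s0 => /(canRL (divfK _)) -> //; last by rewrite gt_eqF.
rewrite normrM mulrC (gtr0_norm z0) (normrM (tau s _)); apply: ler_pM; rewrite ?mulr_ge0 ?(ltW z0)//.
  by have := zol_le0 v s0; have := zol_le0 w s0; lra.
by rewrite -[leRHS]mul1r ler_pM ?tau_abs_le1 ?tau_near.
Qed.

Lemma zol_continuous s : 0 < s -> continuous (zol s).
Proof.
move=> s0 w; apply/cvgrPdist_le => /= eps e0.
have z0 := zol_gt0 0 s0.
near=> v.
have vw1 : `|v - w| < 2 * s.
  rewrite distrC; near: v; apply: (@nbhsx_ballx _ _ w (2 * s)).
  by rewrite mulr_gt0.
apply: le_trans (zol_lip s0 vw1) _.
rewrite mulrC -ler_pdivlMr ?(mulr_gt0 (ltr0n R 2) z0)//; apply: ltW.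
rewrite distrC; near: v; apply: (@nbhsx_ballx _ _ w (eps / (2 * zol s 0))).
by rewrite divr_gt0 ?(mulr_gt0 (ltr0n R 2) z0).
Unshelve. all: by end_near. Qed.

(** The shift moves the [L] points by one step; the point that enters and the one that leaves differ
    by [2 * L * s], which changes only the sign of [tau]. *)
Lemma prod_tau_abs_shift s t L : (0 < L)%N -> 0 < s ->
  \prod_(0 <= i < L) `|tau (L%:R * s) (t - 2 * s + ((2 * i + 1)%:R - L%:R) * s)| =
  \prod_(0 <= i < L) `|tau (L%:R * s) (t + ((2 * i + 1)%:R - L%:R) * s)|.
Proof.
move=> L0 s0; have S0 : 0 < L%:R * s by rewrite mulr_gt0// ltr0n.
case: L L0 S0 => // L _ S0; rewrite big_nat_recl// big_nat_recr//= mulrC.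
congr (_ * _).
  apply: eq_bigr => i _; congr (`|tau _ _|).
  by rewrite -[i.+1]addn1; ring.
rewrite -[RHS]normrN -tau_shift//; congr (`|tau _ _|).
by rewrite -[L.+1]addn1; ring.
Qed.

(** Induction on [m] brings [t] into []-s, s]] by shifts. There [prod_tau_le] applies, except at
    [t = s], where the last factor vanishes. *)
Lemma prod_tau_abs_le s t L m : (0 < L)%N -> 0 < s ->
  - ((2 * m + 1)%:R * s) < t <= s ->
  \prod_(0 <= i < L) `|tau (L%:R * s) (t + ((2 * i + 1)%:R - L%:R) * s)| <= tau s 0.
Proof.
move=> L0 s0; have S0 : 0 < L%:R * s by rewrite mulr_gt0// ltr0n.
elim: m t => [|m IH] t /andP[t1 t2]; last first.
  have [t3|t3] := ltP (- s) t.
    apply: IH; rewrite t2 andbT (le_lt_trans _ t3)//.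
    by rewrite lerN2 ler_peMl ?(ltW s0)// ler1n addn1.
  rewrite (_ : t = (t + 2 * s) - 2 * s); last by ring.
  rewrite prod_tau_abs_shift// IH//; apply/andP; split; last by lra.
  rewrite ltrNl in t1; rewrite ltrNl; move: t1.
  have -> : (2 * m.+1 + 1)%:R = (2 * m + 1)%:R + 2 :> R.
    by rewrite -natrD; congr (_%:R); lia.
  by rewrite mulrDl; lra.
move: t1; rewrite muln0 add0n mul1r => t1.
have [->|tns] := eqVneq t s.
  case: L L0 S0 => // L _ S0; rewrite big_nat_recr//=.
  rewrite (_ : s + _ = L.+1%:R * s) ?tau_self ?normr0 ?mulr0 ?tau0_ge0//.
  by rewrite -[L.+1]addn1; ring.
have ts : `|t| < s by rewrite ltr_norml t1 lt_neqAle tns t2.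
apply: le_trans (tau_le0 t s0); apply: le_trans (prod_tau_le L0 s0 ts).
rewrite big_nat [leRHS]big_nat; apply: ler_prod => i /andP[_ iL].
rewrite normr_ge0 /= ger0_norm// tau_ge0//.
have iL' : i%:R + 1 <= L%:R :> R by rewrite natr1 ler_nat.
have i0 : 0 <= i%:R * s by rewrite mulr_ge0// ltW.
have iS : i%:R * s + s <= L%:R * s by rewrite -{2}[s]mul1r -mulrDl ler_wpM2r// ltW.
rewrite (_ : _ + _ = t + 2 * (i%:R * s) + s - L%:R * s); last first.
  by rewrite natrD natrM; ring.
by rewrite ltr_norml; apply/andP; split; lra.
Qed.

(** The nodes are normalised values of [zol s] at odd multiples of [h = s / (2 l)]. Writing [y] as
    [zol s w / zol s 0], [zol_tau] splits each factor into two values of [tau s]; the [2 l]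
    resulting points have spacing [2 * h], so their product is at most [tau h 0]. *)
Lemma zolotarev_nodes s (l : nat) : 0 < s -> (0 < l)%N ->
  exists2 node : nat -> R, (forall j, 0 < node j) &
    forall y, 4 * expR (- s) <= y <= 1 ->
      \prod_(0 <= j < l) `|(y - node j) / (y + node j)| <=
        2 * expR (- (l%:R * pi ^+ 2 / (2 * s))).
Proof.
move=> s0 l0; have l0' : 0 < l%:R :> R by rewrite ltr0n.
pose h := s / (2 * l%:R); have h0 : 0 < h by rewrite divr_gt0 ?mulr_gt0.
have sE : s = (2 * l)%:R * h.
  by rewrite /h natrM mulrC divfK// gt_eqF// mulr_gt0.
have z0 := zol_gt0 0 s0.
pose v j := (2 * j + 1)%:R * h.
exists (fun j => zol s (v j) / zol s 0) => [j|y /andP[y1 y2]].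
  by rewrite divr_gt0 ?zol_gt0.
have [w ws wy] : exists2 w, w \in `[0, s] & zol s w = y * zol s 0.
  apply: (@IVT _ (zol s) 0 s (y * zol s 0)); first exact: ltW.
    by apply: continuous_subspaceT => x; exact: zol_continuous.
  have H1 : y * zol s 0 <= zol s 0 by rewrite ler_piMl// ltW.
  have H2 : zol s s <= y * zol s 0.
    by apply: le_trans (zol_ratio s0) _; rewrite ler_wpM2r// ltW.
  by rewrite ge_min le_max H1 H2 orbT.
move: ws; rewrite in_itv/= => /andP[w0 w1].
have fac j : `|(y - zol s (v j) / zol s 0) / (y + zol s (v j) / zol s 0)| =
    `|tau s (w + v j - s)| * `|tau s (w - v j - s)|.
  have -> : (y - zol s (v j) / zol s 0) / (y + zol s (v j) / zol s 0) =
      (zol s w - zol s (v j)) / (zol s w + zol s (v j)).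
    have zj := zol_gt0 (v j) s0; have zw := zol_gt0 w s0.
    have y0 : 0 < y by rewrite -(pmulr_lgt0 _ z0) -wy.
    rewrite wy; move: (zol s 0) (zol s (v j)) z0 zj => z z' z0' z'0.
    by field; rewrite !gt_eqF ?addr_gt0 ?mulr_gt0 ?divr_gt0.
  rewrite zol_tau// (normrM (tau s _)) addrC; congr (_ * _).
    by congr (`|tau _ _|); ring.
  rewrite -(tauN (v j - w - s))// (_ : w - v j - s = - (v j - w - s) - 2 * s).
    by rewrite tau_shift// normrN.
  by ring.
under eq_bigr do rewrite fac.
have := @prod_tau_abs_le h (w - s) (2 * l) l _ h0 _; rewrite -sE => HH.
have wb : - ((2 * l + 1)%:R * h) < w - s <= h.
  apply/andP; split; last by lra.
  by rewrite natrD mulrDl -sE mul1r; lra.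
have l20 : (0 < 2 * l)%N by rewrite muln_gt0.
have B := le_trans (HH l20 wb) (tau0_le h0).
rewrite [leRHS](_ : _ = 2 * expR (- (pi ^+ 2 / (4 * h)))); last first.
  congr (_ * expR (- _)); rewrite /h; move: (pi ^+ 2) => p.
  by field; rewrite !gt_eqF.
apply: le_trans B.
  (* Of the [2 l] points, the upper half are the [w + v j - s] and the lower half, in reverse order,
     the [w - v j - s]. *)
  have shl (f : nat -> R) : \prod_(l <= i < l + l) f i = \prod_(0 <= i < l) f (i + l)%N.
    by rewrite -{1}[l]add0n big_addn addnK.
  rewrite mul2n -addnn [leRHS](@big_cat_nat _ _ _ l) ?leq_addr//= shl big_split/= mulrC.
  rewrite [X in X * _]big_nat_rev/= add0n le_eqVlt; apply/orP; left; apply/eqP.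
  congr (_ * _).
    rewrite big_nat [RHS]big_nat; apply: eq_bigr => i /andP[_ il].
    congr (`|tau _ _|); rewrite /v; set k := (l - i.+1)%N.
    have lE : l%:R = k%:R + i%:R + 1 :> R by rewrite -addrA natr1 -natrD subnK.
    by rewrite (natrD _ l l) lE; ring.
  apply: eq_bigr => i _; congr (`|tau _ _|); by rewrite /v; ring.
Qed.

End Zolotarev.

Section CauchyKernel.
Variable R : realType.

(** The hypothesis reads [1 / c = u j * v j / c + p j * q j]; it is substituted into the remaining
    [1 / c], one index at a time. *)
Lemma telescope_rank_one (K : fieldType) (u v p q : nat -> K) (c : K) (l : nat) :
  (forall j, 1 - u j * v j = c * (p j * q j)) -> c != 0 ->
  c^-1 = (\prod_(0 <= j < l) u j) * ((\prod_(0 <= j < l) v j) / c) +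
    \sum_(0 <= j < l) ((\prod_(0 <= i < j) u i) * p j) * ((\prod_(0 <= i < j) v i) * q j).
Proof.
move=> uv c0; elim: l => [|l IH].
  by rewrite !big_nil mul1r div1r addr0.
rewrite [LHS]IH !big_nat_recr//= addrA [RHS]addrAC; congr (_ + _).
move: (\prod_(0 <= i < l) u i) (\prod_(0 <= i < l) v i) => X Y.
rewrite (_ : X * p l * (Y * q l) = X * Y * (c * (p l * q l)) / c); last first.
  by field.
by rewrite -uv; field.
Qed.

Lemma cauchy_kernel_split (a b : R) (l : nat) : 0 < a -> a < b -> (0 < l)%N ->
  exists U W : R -> R, exists G H : nat -> R -> R,
    let k := 2 * expR (- (l%:R * pi ^+ 2 / (2 * ln (8 * b / a)))) in
    forall x y, a <= x -> a <= y <= b ->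
    [/\ (x + y)^-1 = U x * (W y / (x + y)) + \sum_(0 <= j < l) G j x * H j y,
        `|U x| <= k & `|W y| <= k].
Proof.
move=> a0 ab l0; have b0 : 0 < b by exact: lt_trans ab.
have s0 : 0 < ln (8 * b / a) by rewrite ln_gt0// ltr_pdivlMr//; lra.
have [node node0 nodeP] := zolotarev_nodes s0 l0.
have sE : 4 * expR (- ln (8 * b / a)) = a / (2 * b).
  rewrite expRN lnK ?posrE ?divr_gt0 ?mulr_gt0//.
  by field; rewrite !gt_eqF.
rewrite sE in nodeP.
(* [e] and [g] below are the roots of [z ^ 2 - 2 b z + a ^ 2]. As [g * e = a ^+ 2], both maps [T]
   and [T'] send [a] to [a / e], which exceeds [a / (2 * b)] since [e < 2 * b]; moreover [T' b = 1],
   and [T] tends to 1 at infinity. *)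
have [d d0 dE] : exists2 d : R, 0 < d & d ^+ 2 = b ^+ 2 - a ^+ 2.
  have h : 0 < b ^+ 2 - a ^+ 2 by rewrite subr_gt0 ltr_sqr ?nnegrE ?ltW.
  by exists (Num.sqrt (b ^+ 2 - a ^+ 2)); rewrite ?sqrtr_gt0// sqr_sqrtr// ltW.
have db : d < b by rewrite -ltr_sqr ?nnegrE ?ltW// dE; have := exprn_gt0 2 a0; lra.
pose e := b + d; pose g := b - d.
have ge : g * e = a ^+ 2 by rewrite /g /e -(subr0 (a ^+ 2)); have := dE; nra.
have g0 : 0 < g by rewrite subr_gt0.
have ga : g <= a by rewrite /g in ge *; rewrite /e in ge; nra.
(* The Moebius map [T] sends [a, +oo[ into [a / (2 b), 1], and
   [T' y = - T (- y)]: it symmetrises the pair [a, +oo[, [-b, -a]. *)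
pose T x := (x + g) / (x + e); pose T' y := (y - g) / (e - y).
have Tb x : a <= x -> a / (2 * b) <= T x <= 1.
  move=> ax; have xe : 0 < x + e by rewrite /e; lra.
  apply/andP; split; last by rewrite ler_pdivrMr// mul1r /g /e; lra.
  rewrite ler_pdivrMr ?mulr_gt0// mulrAC ler_pdivlMr//.
  rewrite /g /e in ge *; nra.
have T'b y : a <= y <= b -> a / (2 * b) <= T' y <= 1.
  move=> /andP[ay yb]; have ye : 0 < e - y by rewrite /e; lra.
  apply/andP; split; last by rewrite ler_pdivrMr// mul1r /g /e; lra.
  rewrite ler_pdivrMr ?mulr_gt0// mulrAC ler_pdivlMr//.
  rewrite /g /e in ge ga *; nra.
pose u x j := (T x - node j) / (T x + node j).
pose v y j := (T' y - node j) / (T' y + node j).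
exists (fun x => \prod_(0 <= j < l) u x j), (fun y => \prod_(0 <= j < l) v y j).
exists (fun j x => (\prod_(0 <= i < j) u x i) * (4 * d * node j / ((T x + node j) * (x + e)))).
exists (fun j y => (\prod_(0 <= i < j) v y i) * ((T' y + node j) * (e - y))^-1).
move=> k x y ax ayb; have /andP[ay yb] := ayb; split; last 2 first.
- by rewrite normr_prod; apply: nodeP; exact: Tb.
- by rewrite normr_prod; apply: nodeP; exact: T'b.
apply: telescope_rank_one; last by rewrite gt_eqF//; lra.
have xe : 0 < x + e by rewrite /e; lra.
have ye : 0 < e - y by rewrite /e; lra.
have c0 : 0 < a / (2 * b) by rewrite divr_gt0 ?mulr_gt0.
move=> j; rewrite /u /v.
have Tn : 0 < T x + node j by rewrite addr_gt0//; case/andP: (Tb x ax) => + _;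
  exact: lt_le_trans.
have T'n : 0 < T' y + node j by rewrite addr_gt0//; case/andP: (T'b y ayb) => + _;
  exact: lt_le_trans.
(* [1 - u * v] is proportional to [T x + T' y], which is [x + y] times a function of [x] times a
   function of [y]: the hypothesis of the telescoping. *)
have TT : T x + T' y = 2 * d * (x + y) / ((x + e) * (e - y)).
  rewrite /T /T' (_ : 2 * d = e - g); last by rewrite /e /g; ring.
  by field; rewrite !gt_eqF.
rewrite (_ : 1 - _ = 2 * node j * (T x + T' y) / ((T x + node j) * (T' y + node j))).
  rewrite TT; move: (T x + node j) (T' y + node j) Tn T'n => t t' t0 t'0.
  by field; rewrite !gt_eqF.
by move: (T x) (T' y) (node j) Tn T'n => t t' n t0 t'0; field; rewrite !gt_eqF.
Qed.

End CauchyKernel.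

(** * Singular values *)

Section Vectors.
Variable R : realType.
Local Notation C := R[i].
Local Notation Re := complex.Re.
Local Notation Im := complex.Im.

Definition ip n (u v : 'cV[C]_n) : C := (u^t* *m v) ord0 ord0.
Definition sqn n (v : 'cV[C]_n) : R := Re (ip v v).

Lemma ipE n (u v : 'cV[C]_n) : ip u v = \sum_i (u i ord0)^* * v i ord0.
Proof. by rewrite /ip !mxE; apply: eq_bigr => i _; rewrite !mxE. Qed.

Lemma Re_sum I r (P : pred I) (F : I -> C) :
  Re (\sum_(i <- r | P i) F i) = \sum_(i <- r | P i) Re (F i).
Proof. by elim/big_rec2: _ => [//|i x y _ <-]; case: (F i) y => a b [c d]. Qed.

Definition sqc (x : C) : R := Re x ^+ 2 + Im x ^+ 2.

Lemma conjc_mul (x : C) : x^* * x = (sqc x)%:C.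
Proof.
case: x => a b; rewrite /sqc; apply/eqP; rewrite eq_complex /=.
by apply/andP; split; apply/eqP; ring.
Qed.

Lemma sqc_ge0 x : 0 <= sqc x.
Proof. by rewrite addr_ge0 ?sqr_ge0. Qed.

Lemma sqnE n (v : 'cV[C]_n) : sqn v = \sum_i sqc (v i ord0).
Proof.
rewrite /sqn ipE Re_sum; apply: eq_bigr => i _.
by rewrite conjc_mul.
Qed.

Lemma sqn_ge0 n (v : 'cV[C]_n) : 0 <= sqn v.
Proof. by rewrite sqnE sumr_ge0// => i _; exact: sqc_ge0. Qed.

Lemma sqc_eq0 x : sqc x = 0 -> x = 0.
Proof.
case: x => a b /eqP; rewrite /sqc paddr_eq0 ?sqr_ge0//= !sqrf_eq0.
by move=> /andP[/eqP-> /eqP->].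
Qed.

Lemma sqn_gt0 n (v : 'cV[C]_n) : v != 0 -> 0 < sqn v.
Proof.
move=> v0; rewrite lt_neqAle sqn_ge0 andbT eq_sym; apply/negP => /eqP.
rewrite sqnE => /eqP; rewrite psumr_eq0 => [/allP H|i _]; last exact: sqc_ge0.
move/negP: v0; apply; apply/eqP/matrixP => i j; rewrite ord1 mxE.
by apply: sqc_eq0; apply/eqP/H; rewrite mem_index_enum.
Qed.

Lemma ip_sqn n (v : 'cV[C]_n) : ip v v = (sqn v)%:C.
Proof.
rewrite sqnE ipE rmorph_sum; apply: eq_bigr => i _; exact: conjc_mul.
Qed.

Lemma ip_adj m n (A : 'M[C]_(m, n)) u v : ip u (A *m v) = ip (A^t* *m u) v.
Proof. by rewrite /ip trmx_mul map_mxM /= trmxCK mulmxA. Qed.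

Lemma unitarymx_adjK n (P : 'M[C]_n) : P \is unitarymx -> P^t* *m P = 1%:M.
Proof. by move=> Pu; apply: mulmx1C; exact/unitarymxP. Qed.

Lemma sqn_unitary n (P : 'M[C]_n) v : P \is unitarymx -> sqn (P *m v) = sqn v.
Proof.
by move=> Pu; rewrite /sqn ip_adj mulmxA (unitarymx_adjK Pu) mul1mx.
Qed.

(** Sum the weighted inequality [key] with weights [y] and [x]; if one bound is zero, an arbitrarily
    large weight on the vanishing vector replaces them. *)
Lemma cauchy_schwarz n (u v : 'cV[C]_n) (x y : R) : 0 <= x -> 0 <= y ->
  sqn u <= x ^+ 2 -> sqn v <= y ^+ 2 -> Re (ip u v) <= x * y.
Proof.
move=> x0 y0 ux vy.
have key (s t : R) : 2 * s * t * Re (ip u v) <= s ^+ 2 * sqn u + t ^+ 2 * sqn v.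
  rewrite !sqnE ipE Re_sum !mulr_sumr -big_split/=; apply: ler_sum => i _.
  case: (u i ord0) (v i ord0) => a b [c d]; rewrite /sqc /=.
  have := sqr_ge0 (s * a - t * c); have := sqr_ge0 (s * b - t * d).
  by rewrite !expr2; lra.
have [xE|xN] := eqVneq x 0.
  have u0 : sqn u = 0.
    by apply/eqP; rewrite eq_le sqn_ge0 andbT (le_trans ux)// xE expr0n.
  rewrite xE mul0r leNgt; apply/negP => r0.
  have := key ((sqn v + 1) / Re (ip u v)) 1.
  rewrite u0 mulr0 add0r mulr1 expr1n mul1r -mulrA divfK ?gt_eqF//.
  by move: (sqn v) (sqn_ge0 v); clear; move=> V V0 H; lra.
have [yE|yN] := eqVneq y 0.
  have v0 : sqn v = 0.
    by apply/eqP; rewrite eq_le sqn_ge0 andbT (le_trans vy)// yE expr0n.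
  rewrite yE mulr0 leNgt; apply/negP => r0.
  have := key 1 ((sqn u + 1) / Re (ip u v)).
  rewrite v0 mulr0 addr0 mulr1 expr1n mul1r -mulrA divfK ?gt_eqF//.
  by move: (sqn u) (sqn_ge0 u); clear; move=> V V0 H; lra.
have {}x0 : 0 < x by rewrite lt_neqAle eq_sym xN.
have {}y0 : 0 < y by rewrite lt_neqAle eq_sym yN.
have := key y x => H.
have : 2 * y * x * Re (ip u v) <= y ^+ 2 * x ^+ 2 + x ^+ 2 * y ^+ 2.
  by apply: le_trans H _; rewrite lerD// ler_wpM2l ?sqr_ge0.
rewrite (_ : _ + _ = 2 * y * x * (x * y)); last by ring.
by rewrite ler_pM2l// !mulr_gt0.
Qed.

End Vectors.

Section SingularValues.
Variable R : realType.
Local Notation C := R[i].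
Local Notation Re := complex.Re.
Local Notation Im := complex.Im.

Section Fixed.
Variables (n : nat) (X : 'M[C]_n).
Local Notation S := (X^t* *m X).
Local Notation P := (spectralmx S).
Local Notation d i := (spectral_diag S ord0 i).

Lemma gram_spectralE : S = P^t* *m diag_mx (spectral_diag S) *m P.
Proof.
rewrite -invmx_unitary ?spectral_unitarymx//; apply/orthomx_spectralP.
by apply/normalmxP; rewrite trmx_mul map_mxM /= trmxCK.
Qed.

Lemma sqn_gram (v : 'cV[C]_n) : ip v (S *m v) = (sqn (X *m v))%:C.
Proof. by rewrite -ip_sqn -mulmxA [LHS]ip_adj trmxCK. Qed.

Lemma ip_diag (D : 'rV[C]_n) (w : 'cV[C]_n) :
  Re (ip w (diag_mx D *m w)) = \sum_i Re (D ord0 i) * sqc (w i ord0).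
Proof.
rewrite ipE Re_sum; apply: eq_bigr => i _; rewrite mul_diag_mx mxE mulrCA conjc_mul.
by case: (D ord0 i) => a b /=; rewrite mulr0 subr0.
Qed.

Lemma sqn_mulmx (v : 'cV[C]_n) :
  sqn (X *m v) = \sum_i Re (d i) * sqc ((P *m v) i ord0).
Proof.
rewrite -ip_diag -[LHS]/(Re (sqn (X *m v))%:C) -sqn_gram.
transitivity (Re (ip v (P^t* *m diag_mx (spectral_diag S) *m P *m v))).
  by rewrite -gram_spectralE.
by rewrite -!mulmxA [in LHS]ip_adj trmxCK.
Qed.

Lemma Re_gram_ge0 i : 0 <= Re (d i).
Proof.
have := sqn_ge0 (X *m (P^t* *m delta_mx i ord0)).
rewrite sqn_mulmx mulmxA (unitarymxP (spectral_unitarymx _)) mul1mx.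
rewrite (bigD1 i)//= big1 => [|j ji]; last first.
  by rewrite !mxE (negPf ji) /sqc /= expr0n addr0 mulr0.
by rewrite !mxE !eqxx /sqc /= expr1n expr0n !addr0 mulr1.
Qed.

Local Notation sv i := (Num.sqrt (Re (d i))).

Lemma size_singular_values : size (singular_values X) = n.
Proof. by rewrite size_sort size_map size_enum_ord. Qed.

Lemma mem_singular_values i : sv i \in singular_values X.
Proof. by rewrite mem_sort; apply: map_f; rewrite mem_enum. Qed.

Lemma singular_values_nth i j : (i <= j < n)%N ->
  (singular_values X)`_j <= (singular_values X)`_i.
Proof.
move=> /andP[ij jn].
have tr : transitive (fun x y : R => y <= x) by move=> x y z yx zx; exact: le_trans zx yx.
have so : sorted (fun x y : R => y <= x) (singular_values X).
  by apply: sort_sorted => x y; exact: le_total.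
apply: (sorted_leq_nth tr _ 0 so) => //; rewrite ?inE ?size_singular_values//.
exact: leq_ltn_trans jn.
Qed.

Lemma sv_le_norm i : sv i <= spectral_norm X.
Proof.
have /(nthP 0) [j jn <-] := mem_singular_values i.
by apply: singular_values_nth; rewrite -size_singular_values.
Qed.

Lemma spectral_norm_ge0 : 0 <= spectral_norm X.
Proof.
rewrite /spectral_norm /sigma; have [n0|n0] := posnP n.
  by rewrite nth_default// size_singular_values n0.
exact: le_trans (sqrtr_ge0 _) (sv_le_norm (Ordinal n0)).
Qed.

Lemma sqn_mulmx_le (v : 'cV[C]_n) : sqn (X *m v) <= spectral_norm X ^+ 2 * sqn v.
Proof.
rewrite sqn_mulmx -(sqn_unitary v (spectral_unitarymx S)) sqnE mulr_sumr.
apply: ler_sum => i _; rewrite ler_wpM2r ?sqc_ge0//.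
rewrite -[leLHS]sqr_sqrtr ?Re_gram_ge0// ler_sqr ?nnegrE ?spectral_norm_ge0//.
exact: sv_le_norm.
Qed.

Lemma gram_eigenvector i :
  S *m (P^t* *m delta_mx i ord0) = d i *: (P^t* *m delta_mx i ord0) :> 'cV_n.
Proof.
transitivity (P^t* *m diag_mx (spectral_diag S) *m P *m (P^t* *m delta_mx i ord0) : 'cV_n).
  by rewrite -gram_spectralE.
rewrite -!mulmxA (mulmxA P) (unitarymxP (spectral_unitarymx _)) mul1mx.
rewrite scalemxAr; congr (_ *m _); apply/matrixP => j k.
rewrite ord1 mul_diag_mx !mxE.
by have [->//|_] := eqVneq j i; rewrite !mulr0.
Qed.

Lemma spectral_diag_real i : d i = (sv i ^+ 2)%:C.
Proof.
rewrite sqr_sqrtr ?Re_gram_ge0//; set w : 'cV_n := P^t* *m delta_mx i ord0.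
have w1 : ip w w = 1.
  rewrite /w ip_adj trmxCK mulmxA (unitarymxP (spectral_unitarymx _)) mul1mx.
  rewrite ipE (bigD1 i)//= big1 => [|j ji].
    by rewrite !mxE !eqxx /= addr0 mulr1 rmorph1.
  by rewrite !mxE (negPf ji) /= mulr0.
have := sqn_gram w; rewrite gram_eigenvector /ip -scalemxAr mxE -/(ip w w) w1 mulr1.
by move=> ->.
Qed.

Lemma top_singular_vector : (0 < n)%N ->
  exists2 v : 'cV[C]_n, v != 0 & S *m v = (spectral_norm X ^+ 2)%:C *: v.
Proof.
move=> n0.
have /(mem_nth 0) : (0 < size (singular_values X))%N by rewrite size_singular_values.
rewrite mem_sort => /mapP[i _ si].
exists (P^t* *m delta_mx i ord0).
  apply/negP => /eqP /(congr1 (mulmx P)).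
  rewrite mulmxA (unitarymxP (spectral_unitarymx _)) mul1mx mulmx0.
  by move/matrixP/(_ i ord0); rewrite !mxE !eqxx => /eqP; rewrite oner_eq0.
by rewrite /spectral_norm /sigma /= si -spectral_diag_real gram_eigenvector.
Qed.

(* The half of Courant-Fischer that only needs dimension counting. *)
Lemma sigma_le m p (c : R) (K : 'M[C]_(p, n)) : 0 <= c -> (\rank K <= m)%N ->
  (forall v : 'cV[C]_n, K *m v = 0 -> sqn (X *m v) <= c ^+ 2 * sqn v) ->
  sigma (1 + m) X <= c.
Proof.
move=> c0 Km H; rewrite /sigma /= leNgt; apply/negP => cs.
(* For [m >= n] the singular value is the default 0 of [nth], which cannot exceed [c]. *)
have mn : (m < n)%N.
  rewrite ltnNge; apply/negP => nm; move: cs.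
  by rewrite nth_default ?size_singular_values// ltNge c0.
pose I := [set i | c < sv i]%SET.
have mI : (m < #|I|)%N.
  have -> : #|I| = count (fun x => c < x) (singular_values X).
    rewrite (permP (permEl (perm_sort _ _))) count_map -sum1_card -sum1_count.
    by rewrite big_enum_cond/=; apply: eq_bigl => i; rewrite inE.
  rewrite -(cat_take_drop m.+1 (singular_values X)) count_cat.
  apply: leq_trans (leq_addr _ _).
  have st : size (take m.+1 (singular_values X)) = m.+1.
    by rewrite size_takel// size_singular_values.
  rewrite -[X in (X <= _)%N]st -[X in (X <= _)%N](count_predC (fun x => c < x)).
  rewrite -[X in (_ <= X)%N]addn0 leq_add2l leqn0 -leqn0 leqNgt -has_count.
  apply/negP => /hasP[x /(nthP 0)[i + <-]]; rewrite st => im.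
  rewrite nth_take// /= => /negP; apply.
  by apply: lt_le_trans cs _; apply: singular_values_nth; rewrite -ltnS im.
(* [y *m N = 0] says that [K] kills the combination, with coefficients [y], of the eigenvectors
   indexed by [I]. A nonzero such [y] exists because the rank of [K] is at most [m < #|I|]. *)
pose E : 'M[C]_(#|I|, n) := \matrix_(i, j) (enum_val i == j)%:R.
pose N := E *m (P^t*)^T *m K^T.
have kN : kermx N != 0.
  rewrite kermx_eq0 /row_free neq_ltn (leq_ltn_trans _ mI)//.
  by apply: leq_trans (mxrankM_maxr _ _) _; rewrite mxrank_tr.
have [y yN y0] := rowV0Pn kN.
pose w := (y *m E)^T.
have wI i : i \notin I -> w i ord0 = 0.
  move=> iI; rewrite !mxE big1// => j _; rewrite !mxE.
  by case: eqP => [ji|]; [move: iI; rewrite -ji enum_valP|rewrite mulr0].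
have wE j : w (enum_val j) ord0 = y ord0 j.
  rewrite !mxE (bigD1 j)//= big1 => [|i ij]; first by rewrite !mxE eqxx mulr1 addr0.
  by rewrite !mxE (inj_eq enum_val_inj) (negPf ij) mulr0.
have w0 : w != 0.
  apply: contraNneq y0 => w0; apply/eqP/matrixP => i j; rewrite ord1 -wE w0 !mxE //.
pose v := P^t* *m w.
have Kv : K *m v = 0.
  apply: trmx_inj; rewrite trmx0 !trmx_mul trmxK -(mulmxA y) -(mulmxA y).
  exact/sub_kermxP.
have Pv : P *m v = w by rewrite mulmxA (unitarymxP (spectral_unitarymx _)) mul1mx.
have := H v Kv; rewrite sqn_mulmx -(sqn_unitary v (spectral_unitarymx S)) Pv leNgt.
move/negP; apply; rewrite sqnE mulr_sumr.
have [i wi] : exists i, w i ord0 != 0.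
  by move/cV0Pn : w0.
rewrite (bigD1 i)//= [ltRHS](bigD1 i)//=.
have iI : i \in I by apply: contraNT wi => /wI ->.
have lt_sv j : j \in I -> c ^+ 2 < Re (d j).
  by rewrite inE => csv; rewrite -[ltRHS]sqr_sqrtr ?Re_gram_ge0// ltr_sqr ?nnegrE ?sqrtr_ge0.
apply: ltr_leD.
  rewrite ltr_pM2r ?lt_sv// lt_neqAle sqc_ge0 andbT eq_sym.
  by apply: contraNneq wi => /sqc_eq0 ->.
apply: ler_sum => j _; have [jI|jI] := boolP (j \in I).
  by rewrite ler_wpM2r ?sqc_ge0// ltW// lt_sv.
by rewrite wI// /sqc /= expr0n addr0 !mulr0.
Qed.

End Fixed.
End SingularValues.

(** * Norm of the Sylvester solution operator *)

Section Multiplier.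
Variable R : realType.
Local Notation C := R[i].
Local Notation Re := complex.Re.

Lemma spectral_norm0 (Y : 'M[C]_0) : spectral_norm Y = 0.
Proof. by rewrite /spectral_norm /sigma nth_default// size_singular_values. Qed.

Lemma ipDr n (u v w : 'cV[C]_n) : ip u (v + w) = ip u v + ip u w.
Proof. by rewrite /ip mulmxDr mxE. Qed.

Lemma ipZl n (s : R) (u v : 'cV[C]_n) : ip (s%:C *: u) v = s%:C * ip u v.
Proof.
rewrite !ipE mulr_sumr; apply: eq_bigr => i _; rewrite mxE rmorphM/=.
have -> : Num.conj (s%:C : C) = s%:C by apply/eqP; rewrite eq_complex /= oppr0 !eqxx.
by rewrite mulrA.
Qed.

Lemma Re_mulC (s : R) (x : C) : Re (s%:C * x) = s * Re x.
Proof. by case: x => a b /=; rewrite mul0r subr0. Qed.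

Lemma sqn_mulmx_sqrt n (G : 'M[C]_n) v :
  sqn (G *m v) <= (spectral_norm G * Num.sqrt (sqn v)) ^+ 2.
Proof. by rewrite exprMn sqr_sqrtr ?sqn_ge0 ?sqn_mulmx_le. Qed.

(* Testing the Sylvester equation on a top pair of singular vectors of the
   solution [Y]. *)
Lemma sylvester_norm n (G Y : 'M[C]_n) (al be : 'I_n -> R) (a b : R) :
  0 < a + b -> (forall i, a <= al i) -> (forall j, b <= be j) ->
  (forall i j, G i j = (al i + be j)%:C * Y i j) ->
  spectral_norm Y <= spectral_norm G / (a + b).
Proof.
case: n G Y al be => [|n] G Y al be ab0 ala beb GY.
  by rewrite !spectral_norm0 mul0r.
have [v v0 vE] := top_singular_vector Y (ltn0Sn n).
set s := spectral_norm Y in vE *; set g := spectral_norm G.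
have s0 : 0 <= s by exact: spectral_norm_ge0.
have g0 : 0 <= g by exact: spectral_norm_ge0.
pose u := Y *m v.
have vp : 0 < sqn v by exact: sqn_gt0.
have uE : sqn u = s ^+ 2 * sqn v.
  rewrite -[LHS]/(Re (sqn u)%:C) -sqn_gram vE /ip -scalemxAr mxE -/(ip v v) ip_sqn.
  by rewrite -rmorphM.
have GE : G *m v = diag_mx (\row_i (al i)%:C) *m u + Y *m (diag_mx (\row_j (be j)%:C) *m v).
  apply/matrixP => i k; rewrite ord1 {k} !mul_diag_mx !mxE mulr_sumr -big_split/=.
  apply: eq_bigr => j _; rewrite GY !mxE rmorphD/=; ring.
(* The first summand of [GE] gives the form of the [al i] at [u]. In the second, moving [Y] to the
   left yields [Y^t* *m u = s ^+ 2 *: v], hence the form of the [be j] at [v]. *)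
have lower : (a + b) * (s ^+ 2 * sqn v) <= Re (ip u (G *m v)).
  rewrite GE ipDr raddfD/= ip_diag ip_adj mulmxA vE ipZl Re_mulC ip_diag mulrDl.
  rewrite -{1}uE (mulrCA b) !sqnE; apply: lerD.
    by rewrite mulr_sumr; apply: ler_sum => i _; rewrite mxE /= ler_wpM2r// sqc_ge0.
  rewrite ler_wpM2l ?sqr_ge0// mulr_sumr.
  by apply: ler_sum => i _; rewrite mxE /= ler_wpM2r// sqc_ge0.
have upper : Re (ip u (G *m v)) <= (s * Num.sqrt (sqn v)) * (g * Num.sqrt (sqn v)).
  apply: cauchy_schwarz; rewrite ?mulr_ge0 ?sqrtr_ge0//; last exact: sqn_mulmx_sqrt.
  by rewrite exprMn sqr_sqrtr ?sqn_ge0// uE.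
have := le_trans lower upper.
rewrite (_ : s * _ * _ = s * g * sqn v); last first.
  by rewrite -[X in _ = _ * X](sqr_sqrtr (sqn_ge0 v)); ring.
rewrite mulrA ler_pM2r// expr2 mulrCA.
have [->|sN] := eqVneq s 0; first by rewrite divr_ge0// ltW.
have {}s0 : 0 < s by rewrite lt_neqAle eq_sym sN.
by rewrite ler_pM2l// ler_pdivlMr// mulrC.
Qed.

End Multiplier.

(** * Cauchy-Stieltjes functions on the positive axis *)

Section Stieltjes.
Variable R : realType.
Local Notation C := R[i].
Local Notation Re := complex.Re.

Lemma cauchy_stieltjes_real (f : C -> C) : cauchy_stieltjes f ->
  exists mu : {measure set (measurableTypeR R) -> \bar R}, forall x : R, 0 < x ->
    mu.-integrable `[0, +oo[ (EFin \o (fun t : measurableTypeR R => (t + x)^-1)) /\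
    f x%:C = (Rintegral mu `[0, +oo[ (fun t : measurableTypeR R => (t + x)^-1))%:C.
Proof.
move=> [mu H]; exists mu => x x0.
have : slit_plane (x%:C : C) by move=> [_ /=]; rewrite leNgt x0.
have E t : (t%:C + x%:C)^-1 = ((t + x)^-1)%:C :> C by rewrite -rmorphD -fmorphV.
move=> /H [+ _ ->].
rewrite (_ : (fun t : measurableTypeR R => complex.Re _) = (fun t => (t + x)^-1)); last first.
  by apply/funext => t; rewrite E.
rewrite (_ : (fun t : measurableTypeR R => complex.Im _) = cst 0); last first.
  by apply/funext => t; rewrite E.
by move=> intx; split => //; rewrite Rintegral_cst//= mul0r.
Qed.

(** The coefficients may have any sign, so the integrands are compared only after the whole sum has
    been moved under the integral. *)
Lemma Rintegral_sum_le (mu : {measure set (measurableTypeR R) -> \bar R})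
    (D : set (measurableTypeR R)) (I : Type) (r : seq I) (c : I -> R)
    (h : I -> measurableTypeR R -> R) (h0 : measurableTypeR R -> R) :
  measurable D -> (forall i, mu.-integrable D (EFin \o h i)) ->
  mu.-integrable D (EFin \o h0) ->
  (forall t, D t -> \sum_(i <- r) c i * h i t <= h0 t) ->
  \sum_(i <- r) c i * Rintegral mu D (h i) <= Rintegral mu D h0.
Proof.
move=> mD ih ih0 le.
have [E iE] : \sum_(i <- r) c i * Rintegral mu D (h i) =
    Rintegral mu D (fun t => \sum_(i <- r) c i * h i t) /\
    mu.-integrable D (EFin \o (fun t => \sum_(i <- r) c i * h i t)).
  elim: r {le} => [|i r [IH1 IH2]].
    rewrite big_nil; under eq_fun do rewrite big_nil.
    by rewrite Rintegral_cst//= mul0r; split => //; exact: integrable0.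
  have iZ : mu.-integrable D (EFin \o (fun t => c i * h i t)).
    rewrite (_ : EFin \o _ = (fun t => (c i)%:E * (EFin \o h i) t)%E) //.
    exact: integrableZl.
  have SE : (fun t => \sum_(j <- i :: r) c j * h j t) =
      (fun t => c i * h i t + \sum_(j <- r) c j * h j t).
    by apply/funext => t; rewrite big_cons.
  rewrite big_cons IH1 SE RintegralD// RintegralZl//; split => //.
  exact: (integrableD mD iZ IH2).
by rewrite E; apply: le_Rintegral.
Qed.

End Stieltjes.

(** * Vectorisation, Kronecker products and matrix functions *)

Lemma index_allpairs_pair (S T : eqType) (s : seq S) (t : seq T) x y :
  x \in s -> y \in t ->
  index (x, y) [seq (a, b) | a <- s, b <- t] = (index x s * size t + index y t)%N.
Proof.
move=> + yt; elim: s => //= a s IH; rewrite inE index_cat size_map.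
have [->|xa /= xs] := eqVneq a x; rewrite /= ?eqxx.
  rewrite (map_f (pair x))//= mul0n add0n index_map// => b c [].
  by [].
rewrite ifF ?IH ?mulSn ?addnA//.
apply/negP => /mapP[b _ [ax _]]; by rewrite ax eqxx in xa.
Qed.

(** Reconciles the indexing of [mxvec], by enumeration rank, with the arithmetic indexing of
    Kronecker products. *)
Lemma mxvec_index_mxtens m n (i : 'I_m) (j : 'I_n) :
  mxvec_index i j = mxtens_index (i, j).
Proof.
apply: val_inj => /=.
have -> : enum_rank (i, j) = index (i, j) (enum {: 'I_m * 'I_n}) :> nat.
  by rewrite -{2}(nth_enum_rank (i, j) (i, j)) index_uniq ?enum_uniq// -cardE.
rewrite enumT unlock /= index_allpairs_pair ?mem_enum//.
by rewrite !index_enum_ord size_enum_ord.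
Qed.

Section MatrixFunction.
Variable R : realType.
Local Notation C := R[i].
Local Notation Re := complex.Re.

(** In the spectral basis each coordinate of [v] is zero or sits at a diagonal entry equal to [x].
    Thus the basis chosen by [spectralmx] for the Sylvester matrix never has to be compared with
    those of [A] and [B]. *)
Lemma mxfun_eigenvector n (f : C -> C) (M : 'M[C]_n) (v : 'cV[C]_n) (x : C) :
  M \is normalmx -> M *m v = x *: v -> mxfun f M *m v = f x *: v.
Proof.
move=> /orthomx_spectralP ME Mv; rewrite /mxfun.
move: (spectralmx M) (spectral_diag M) (spectral_unit M) ME => P d Pu ME.
have Pv : diag_mx d *m (P *m v) = x *: (P *m v).
  rewrite scalemxAr -Mv {1}ME -(mulmxA (invmx P)) -(mulmxA (invmx P)).
  by rewrite (mulmxA P (invmx P)) (mulmxV Pu) mul1mx -mulmxA.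
have Pf : diag_mx (map_mx f d) *m (P *m v) = f x *: (P *m v).
  apply/matrixP => i j; have := congr1 (fun w : 'cV_n => w i j) Pv.
  rewrite /= !mul_diag_mx; move: (P *m v) => w; rewrite !mxE => /eqP.
  rewrite -subr_eq0 -mulrBl mulf_eq0 subr_eq0.
  by move=> /orP[/eqP <-//|/eqP ->]; rewrite !mulr0.
by rewrite -!mulmxA Pf -scalemxAr mulmxA (mulVmx Pu) mul1mx.
Qed.

Lemma colvecE m n (X : 'M[C]_(m, n)) i j :
  colvec X (mxtens_index (j, i)) ord0 = X i j.
Proof. by rewrite mxE -mxvec_index_mxtens mxvecE mxE. Qed.

Lemma colvecK m n (X : 'M[C]_(m, n)) : uncolvec (colvec X) = X.
Proof. by rewrite /uncolvec /colvec trmxK mxvecK trmxK. Qed.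

Lemma sylvester_mxE n (A B X : 'M[C]_n) :
  sylvester_mx A B *m colvec X = colvec (A *m X - X *m B).
Proof.
apply/matrixP => k z; rewrite ord1 {z}; case: (mxtens_indexP k) => j i.
rewrite colvecE [RHS]mxE [LHS]mxE (reindex (@mxtens_index n n)) /=; last first.
  by exists (@mxtens_unindex n n) => p _; rewrite ?mxtens_indexK ?mxtens_unindexK.
rewrite (eq_bigr (fun p : 'I_n * 'I_n =>
  ((j == p.1)%:R * A i p.2 - B p.1 j * (i == p.2)%:R) * X p.2 p.1)); last first.
  move=> [j' i'] _ /=; rewrite colvecE; congr (_ * _).
  by rewrite mxE [X in _ + X]mxE !tensmxE !mxE.
rewrite -(pair_bigA _ (fun j' i' =>
  ((j == j')%:R * A i i' - B j' j * (i == i')%:R) * X i' j')) /=.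
under eq_bigr => j' _.
  rewrite (eq_bigr (fun i' => (j == j')%:R * (A i i' * X i' j') -
     (i == i')%:R * (X i' j' * B j' j))); last by move=> i' _; ring.
  rewrite sumrB -mulr_sumr.
  over.
rewrite sumrB; congr (_ + _).
  rewrite (bigD1 j)//= eqxx mul1r [X in _ + X]big1 ?addr0 ?mxE// => j' jj'.
  by rewrite eq_sym (negPf jj') mul0r.
rewrite [in RHS]mxE [in RHS]mxE; congr (- _); apply: eq_bigr => j' _.
rewrite (bigD1 i)//= eqxx mul1r [X in _ + X]big1 ?addr0// => i' ii'.
by rewrite eq_sym (negPf ii') mul0r.
Qed.

Lemma hermsymmx_adjE n (A : 'M[C]_n) : (A \is hermsymmx) = (A^t* == A).
Proof.
by apply/is_hermitianmxP/eqP; rewrite expr0 scale1r => /esym.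
Qed.

Lemma sylvester_mx_normal n (A B : 'M[C]_n) : A \is hermsymmx -> B \is hermsymmx ->
  sylvester_mx A B \is normalmx.
Proof.
rewrite !hermsymmx_adjE => /eqP AE /eqP BE; apply: hermitian_normalmx.
rewrite hermsymmx_adjE; apply/eqP.
rewrite /sylvester_mx linearB/= map_mxB !trmx_tens !map_mxT.
have BTE : (B^T)^t* = B^T by rewrite -map_trmx BE.
by rewrite AE BTE trmx1 map_mx1.
Qed.

End MatrixFunction.

(** * Diagonalisation and the entrywise multiplier *)

Section Assembly.
Variable R : realType.
Local Notation C := R[i].
Local Notation Re := complex.Re.

Lemma spectrum_in_diag n (a b : R) (A : 'M[C]_n) :
  A \is hermsymmx -> spectrum_in a b A ->
  exists P : 'M[C]_n, exists al : 'I_n -> R,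
  [/\ P \is unitarymx, A = P^t* *m diag_mx (\row_i (al i)%:C) *m P &
      forall i, a <= al i <= b].
Proof.
move=> /hermitian_normalmx /orthomx_spectralP AE sA.
have Pu := spectral_unitarymx A; rewrite invmx_unitary// in AE.
move: (spectralmx A) (spectral_diag A) Pu AE => P d Pu AE.
have dP i : a%:C <= d ord0 i <= b%:C.
  apply: sA; apply/eigenvalueP; exists (delta_mx ord0 i *m P).
    rewrite {1}AE -!mulmxA (mulmxA P) (unitarymxP Pu) mul1mx !mulmxA scalemxAl.
    congr (_ *m _); apply/matrixP => k j; rewrite mul_mx_diag !mxE.
    by have [->|_] := eqVneq j i; rewrite ?andbF ?mul0r ?mulr0// mulrC.
  apply/negP => /eqP /(congr1 (fun Z : 'rV_n => Z *m P^t*)).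
  rewrite /= -mulmxA (unitarymxP Pu) mulmx1 mul0mx => /matrixP/(_ ord0 i).
  by rewrite !mxE !eqxx => /eqP; rewrite oner_eq0.
(* In the order of the complex numbers, comparability with a real forces the imaginary part to
   vanish. *)
have dR i : (Re (d ord0 i))%:C = d ord0 i.
  have := dP i; rewrite !lecE /= => /andP[/andP[/eqP h _] _].
  by case: (d ord0 i) h => x y /= ->.
have dE : \row_i (Re (d ord0 i))%:C = d.
  by apply/matrixP => k i; rewrite mxE dR (ord1 k).
exists P, (fun i => Re (d ord0 i)); split => // [|i]; first by rewrite dE.
by have := dP i; rewrite !lecE /= => /andP[/andP[_ ->] /andP[_ ->]].
Qed.

Lemma colvec_unitary_sum n (P Q Y : 'M[C]_n) :
  colvec (P *m Y *m Q) =
  \sum_i \sum_j Y i j *: colvec (P *m delta_mx i j *m Q).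
Proof.
rewrite {1}(matrix_sum_delta Y) mulmx_sumr mulmx_suml /colvec !linear_sum/=.
apply: eq_bigr => i _; rewrite mulmx_sumr mulmx_suml !linear_sum/=.
by apply: eq_bigr => j _; rewrite -scalemxAr -scalemxAl !linearZ.
Qed.

(** The matrices [P^t* *m delta_mx i j *m Q] are eigenvectors of the Sylvester operator with
    eigenvalues [al i + be j]; expand in them. *)
Lemma mxfun_sylvester n (f : C -> C) (A B P Q Y : 'M[C]_n) (al be : 'I_n -> R) :
  A \is hermsymmx -> B \is hermsymmx -> P \is unitarymx -> Q \is unitarymx ->
  A = P^t* *m diag_mx (\row_i (al i)%:C) *m P ->
  - B = Q^t* *m diag_mx (\row_i (be i)%:C) *m Q ->
  uncolvec (mxfun f (sylvester_mx A B) *m colvec (P^t* *m Y *m Q)) =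
  P^t* *m (\matrix_(i, j) (f (al i + be j)%:C * Y i j)) *m Q.
Proof.
move=> Ah Bh Pu Qu AE BE; rewrite -[RHS]colvecK; congr uncolvec.
pose D1 : 'M[C]_n := diag_mx (\row_i (al i)%:C).
pose D2 : 'M[C]_n := diag_mx (\row_i (be i)%:C).
have D1E i j : D1 *m delta_mx i j = (al i)%:C *: delta_mx i j.
  apply/matrixP => p q; rewrite mul_diag_mx !mxE.
  by have [->//|_] := eqVneq p i; rewrite !mulr0.
have D2E i j : delta_mx i j *m D2 = (be j)%:C *: delta_mx i j.
  apply/matrixP => p q; rewrite mul_mx_diag !mxE mulrC.
  by have [->//|_] := eqVneq q j; rewrite ?andbF !mulr0.
have key i j : mxfun f (sylvester_mx A B) *m colvec (P^t* *m delta_mx i j *m Q) =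
    f (al i + be j)%:C *: colvec (P^t* *m delta_mx i j *m Q).
  apply: mxfun_eigenvector; first exact: sylvester_mx_normal.
  rewrite sylvester_mxE.
  have -> : A *m (P^t* *m delta_mx i j *m Q) - P^t* *m delta_mx i j *m Q *m B =
      (al i + be j)%:C *: (P^t* *m delta_mx i j *m Q).
    have h1 : A *m (P^t* *m delta_mx i j *m Q) = (al i)%:C *: (P^t* *m delta_mx i j *m Q).
      rewrite AE -/D1 (mulmxA _ (_ *m _) Q) (mulmxA _ (P^t*) _) -(mulmxA _ P) (unitarymxP Pu) mulmx1.
      by rewrite -(mulmxA _ D1) D1E -scalemxAr -scalemxAl.
    have h2 : P^t* *m delta_mx i j *m Q *m - B = (be j)%:C *: (P^t* *m delta_mx i j *m Q).
      rewrite BE -/D2 (mulmxA _ _ Q) (mulmxA _ (Q^t*) D2) -(mulmxA _ Q) (unitarymxP Qu) mulmx1.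
      by rewrite -(mulmxA _ _ D2) D2E -scalemxAr -scalemxAl.
    by rewrite -mulmxN h1 h2 -scalerDl rmorphD.
  by rewrite /colvec !linearZ.
rewrite (colvec_unitary_sum (P^t*) Q Y) [RHS]colvec_unitary_sum.
rewrite mulmx_sumr; apply: eq_bigr => i _.
rewrite mulmx_sumr; apply: eq_bigr => j _.
by rewrite -scalemxAr key mxE scalerA mulrC.
Qed.

Lemma spectral_norm_le n (G : 'M[C]_n) (c : R) : 0 <= c ->
  (forall v : 'cV[C]_n, sqn (G *m v) <= c ^+ 2 * sqn v) -> spectral_norm G <= c.
Proof.
move=> c0 H; apply: (@sigma_le _ _ G 0 0 c (0 : 'M[C]_(0, n))) => //.
by rewrite mxrank0.
Qed.

Lemma sqn_diag_le n (d : 'I_n -> R) (k : R) (v : 'cV[C]_n) :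
  (forall i, `|d i| <= k) ->
  sqn (diag_mx (\row_i (d i)%:C) *m v) <= k ^+ 2 * sqn v.
Proof.
move=> dk; rewrite !sqnE mulr_sumr; apply: ler_sum => i _.
rewrite mul_diag_mx !mxE; have := dk i; case: (v i ord0) => x y H.
rewrite /sqc /= !mul0r subr0 addr0 !exprMn -mulrDr ler_wpM2r ?addr_ge0 ?sqr_ge0//.
by rewrite -real_normK ?num_real// ler_sqr ?nnegrE// (le_trans _ H).
Qed.

(** The form is linear in the multiplier [h] with coefficients independent of it, so an integral
    over [t] acts on real scalars only. *)
Lemma Re_ip_hadamard n (h : 'I_n -> 'I_n -> R) (G : 'M[C]_n) (u w : 'cV[C]_n) :
  Re (ip u ((\matrix_(i, j) ((h i j)%:C * G i j)) *m w)) =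
  \sum_(p : 'I_n * 'I_n)
    Re ((u p.1 ord0)^* * (G p.1 p.2 * w p.2 ord0)) * h p.1 p.2.
Proof.
rewrite -(pair_bigA _ (fun i j => Re ((u i ord0)^* * (G i j * w j ord0)) * h i j))/=.
rewrite ipE Re_sum; apply: eq_bigr => i _; rewrite mxE mulr_sumr Re_sum.
apply: eq_bigr => j _; rewrite mxE -mulrA mulrCA Re_mulC mulrC.
by [].
Qed.

(* The multiplier is the integral over [t] of the Cauchy kernels
   [(t + al i + be j)^-1]. As [h q] does not depend on [x = t + al i], the same
   [w] annihilates the rank-one corrections for all [t], and what is left gains
   a factor [k] on the left and a factor [k] on the right. *)
Lemma stieltjes_sylvester_bound n l (f : C -> C) (a b k : R)
    (G : 'M[C]_n) (al be : 'I_n -> R) (U W : R -> R) (g h : nat -> R -> R)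
    (w : 'cV[C]_n) :
  cauchy_stieltjes f -> 0 < a -> 0 <= k ->
  (forall i, a <= al i) -> (forall j, a <= be j <= b) ->
  (forall x y, a <= x -> a <= y <= b ->
    [/\ (x + y)^-1 = U x * (W y / (x + y)) + \sum_(0 <= q < l) g q x * h q y,
        `|U x| <= k & `|W y| <= k]) ->
  (forall q, (q < l)%N -> G *m (diag_mx (\row_j (h q (be j))%:C) *m w) = 0) ->
  sqn ((\matrix_(i, j) (f (al i + be j)%:C * G i j)) *m w) <=
  (k ^+ 2 * spectral_norm G * Re (f (2 * a)%:C)) ^+ 2 * sqn w.
Proof.
move=> /cauchy_stieltjes_real[mu fE] a0 k0 ala beb ker Gw.
pose fR x := Rintegral mu `[0, +oo[ (fun t : measurableTypeR R => (t + x)^-1).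
have bea j : a <= be j by case/andP: (beb j).
have ab0 i j : 0 < al i + be j by have := ala i; have := bea j; lra.
rewrite (fE (2 * a) _).2 ?mulr_gt0// -/(fR _) /=.
have fR0 : 0 <= fR (2 * a).
  apply: Rintegral_ge0 => t /=; rewrite in_itv/= andbT => t0.
  by rewrite invr_ge0; lra.
have XE : (\matrix_(i, j) (f (al i + be j)%:C * G i j)) =
    (\matrix_(i, j) ((fR (al i + be j))%:C * G i j)).
  by apply/matrixP => i j; rewrite !mxE (fE _ (ab0 i j)).2.
rewrite XE; set u := _ *m w.
set s := spectral_norm G; have s0 : 0 <= s by exact: spectral_norm_ge0.
pose su := Num.sqrt (sqn u); pose sw := Num.sqrt (sqn w).
have su0 : 0 <= su by exact: sqrtr_ge0.
have sw0 : 0 <= sw by exact: sqrtr_ge0.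
have suE : sqn u = su ^+ 2 by rewrite sqr_sqrtr// sqn_ge0.
have swE : sqn w = sw ^+ 2 by rewrite sqr_sqrtr// sqn_ge0.
pose Y (t : R) : 'M[C]_n := \matrix_(i, j) (((t + (al i + be j))^-1)%:C * G i j).
have Yw t : 0 <= t -> Y t *m w = diag_mx (\row_i (U (t + al i))%:C) *m
    (Y t *m (diag_mx (\row_j (W (be j))%:C) *m w)).
  move=> t0; apply/matrixP => i z; rewrite ord1 {z} mul_diag_mx [LHS]mxE [RHS]mxE.
  rewrite [X in _ * X]mxE [X in X * _]mxE mulr_sumr.
  have xi : a <= t + al i by have := ala i; lra.
  have E j : Y t i j * w j ord0 = (U (t + al i))%:C *
       (Y t i j * (diag_mx (\row_j0 (W (be j0))%:C) *m w) j ord0) +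
       \sum_(0 <= q < l) (g q (t + al i))%:C *
         (G i j * (diag_mx (\row_j0 (h q (be j0))%:C) *m w) j ord0).
    have [K _ _] := ker _ _ xi (beb j).
    rewrite [Y t i j]mxE addrA; set e := (_ + be j)^-1.
    rewrite {1}(_ : e = U (t + al i) * (W (be j) * e) +
      \sum_(0 <= q < l) g q (t + al i) * h q (be j)); last exact: K.
    rewrite rmorphD rmorph_sum mulrDl mulrDl mulr_suml mulr_suml.
    congr (_ + _); last first.
      by apply: eq_bigr => q _; rewrite mul_diag_mx !mxE rmorphM/=; ring.
    by rewrite mul_diag_mx !mxE !rmorphM/=; ring.
  rewrite (eq_bigr _ (fun j _ => E j)) big_split/= [X in _ + X]exchange_big/=.
  rewrite [X in _ + X]big1_seq ?addr0// => q /=; rewrite mem_index_iota => ql.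
  rewrite -mulr_sumr; have /matrixP/(_ i ord0) := Gw q ql.
  by rewrite mxE => ->; rewrite mxE mulr0.
(* [Y t] solves the Sylvester equation whose two spectra are bounded below by [t + a] and [a]; the
   diagonal factors from [Yw] contribute [k] each. *)
have Ybound t : 0 <= t ->
    Re (ip u (Y t *m w)) <= su * (k ^+ 2 * s * sw) * (t + 2 * a)^-1.
  move=> t0; have ta : 0 < t + 2 * a by lra.
  have Ys : spectral_norm (Y t) <= s / (t + 2 * a).
    rewrite (_ : t + 2 * a = t + a + a); last by ring.
    apply: (sylvester_norm (al := fun i => t + al i) (be := be)) => // [|i|i j].
    - lra.
    - by rewrite lerD2l.
    rewrite mxE mulrA -rmorphM/= addrA divff ?mul1r//.
    by rewrite gt_eqF//; have := ala i; have := bea j; lra.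
  rewrite (_ : su * _ * _ = su * (k * (s / (t + 2 * a) * (k * sw)))); last by ring.
  apply: cauchy_schwarz => //; rewrite ?suE//.
    by rewrite !mulr_ge0// invr_ge0 ltW.
  rewrite Yw// exprMn; apply: le_trans (sqn_diag_le (k := k) _ _) _.
    move=> i; have xi : a <= t + al i by have := ala i; lra.
    by have [] := ker _ _ xi (beb i).
  rewrite ler_wpM2l ?sqr_ge0// exprMn.
  apply: le_trans (sqn_mulmx_le _ _) _; apply: ler_pM; rewrite ?sqr_ge0 ?sqn_ge0//.
    by rewrite ler_sqr ?nnegrE ?spectral_norm_ge0 ?divr_ge0// ltW.
  rewrite exprMn -swE; apply: sqn_diag_le => j.
  by have [] := ker _ _ (lexx a) (beb j).
(* [u] is tested against itself; integrating [Ybound] over [t] turns [(t + 2 * a)^-1] into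
   [fR (2 * a)], and one factor [su] cancels afterwards. *)
have main : su ^+ 2 <= su * (k ^+ 2 * s * sw) * fR (2 * a).
  have -> : su ^+ 2 = \sum_(p : 'I_n * 'I_n)
      Re ((u p.1 ord0)^* * (G p.1 p.2 * w p.2 ord0)) * fR (al p.1 + be p.2).
    by rewrite -suE; exact: (Re_ip_hadamard (fun i j => fR (al i + be j)) G u w).
  have i2a := (fE (2 * a) (mulr_gt0 (ltr0n _ 2) a0)).1.
  rewrite /fR -RintegralZl//.
  apply: Rintegral_sum_le => //.
  - by move=> p; exact: (fE _ (ab0 _ _)).1.
  - exact: (integrableZl _ _ i2a).
  move=> t; rewrite /= in_itv/= andbT => t0.
  apply: le_trans (Ybound t t0).
  by rewrite (Re_ip_hadamard (fun i j => (t + (al i + be j))^-1) G u w).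
rewrite suE swE -exprMn ler_sqr ?nnegrE ?mulr_ge0 ?sqr_ge0//.
have [->|suN] := eqVneq su 0; first by rewrite !mulr_ge0 ?sqr_ge0.
have sup : 0 < su by rewrite lt_neqAle eq_sym suN.
rewrite -(ler_pM2l sup) -expr2; apply: le_trans main _.
by rewrite le_eqVlt; apply/orP; left; apply/eqP; ring.
Qed.

End Assembly.

(** * Rank counting and conclusion *)

Section Rank.
Variable R : realType.
Local Notation C := R[i].
Local Notation Re := complex.Re.

Lemma spectral_norm_unitary_le n (P Q F : 'M[C]_n) :
  P \is unitarymx -> Q \is unitarymx ->
  spectral_norm (P *m F *m Q) <= spectral_norm F.
Proof.
move=> Pu Qu; apply: spectral_norm_le; first exact: spectral_norm_ge0.
move=> v; rewrite -!mulmxA sqn_unitary//.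
by apply: le_trans (sqn_mulmx_le _ _) _; rewrite sqn_unitary.
Qed.

Lemma stack_kernel n k l (V : 'I_l -> 'M[C]_(k, n)) :
  exists2 K : 'M[C]_(l * k, n), (\rank K <= l * k)%N &
    forall v : 'cV[C]_n, K *m v = 0 -> forall q, V q *m v = 0.
Proof.
pose K : 'M[C]_(l * k, n) :=
  \matrix_(p, j) V (mxtens_unindex p).1 (mxtens_unindex p).2 j.
exists K; first exact: rank_leq_row.
move=> v Kv q; apply/matrixP => i z.
have /matrixP/(_ (mxtens_index (q, i)) z) := Kv.
rewrite [RHS]mxE [LHS]mxE => Kqi; rewrite [RHS]mxE -[RHS]Kqi mxE.
by apply: eq_bigr => j _; rewrite mxE mxtens_indexK.
Qed.

End Rank.

Theorem theorem4p11 (R : realType) (a b : R) (f : R[i] -> R[i]) (n k : nat)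
    (A B F : 'M[R[i]]_n) (UF VF : 'M[R[i]]_(n, k)) (l : nat) :
  0 < a -> a < b ->
  cauchy_stieltjes f ->
  posdefmx A -> spectrum_in a b A ->
  posdefmx (- B) -> spectrum_in a b (- B) ->
  F = UF *m VF^T -> \rank F = k ->
  (1 <= l)%N ->
  let X := uncolvec (mxfun f (sylvester_mx A B) *m colvec F) in
  (sigma (1 + l * k) X)%:C
    <= 4 * f (2 * a)%:C * (rho a (2 * b) ^+ l * spectral_norm F)%:C.
Proof.
move=> a0 ab fCS [Ah _] sA [NBh _] sB FE _ l0; cbv zeta; set X := uncolvec _.
have Bh : B \is hermsymmx.
  move: NBh; rewrite !hermsymmx_adjE linearN/= map_mxN => /eqP h.
  by apply/eqP; apply: oppr_inj.
have [P [al [Pu AE alab]]] := spectrum_in_diag Ah sA.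
have [Q [be [Qu BE beab]]] := spectrum_in_diag NBh sB.
have [U [W [g [h ker]]]] := cauchy_kernel_split a0 ab l0.
set kp := 2 * expR _ in ker; have kp0 : 0 <= kp by rewrite mulr_ge0// expR_ge0.
have QQ := unitarymx_adjK Qu; have PP := unitarymx_adjK Pu.
have Pu' : P^t* \is unitarymx by rewrite trmxC_unitary; exact: Pu.
have Qu' : Q^t* \is unitarymx by rewrite trmxC_unitary; exact: Qu.
pose G := P *m F *m Q^t*.
have FG : F = P^t* *m G *m Q.
  by rewrite /G (mulmxA _ _ (Q^t*)) (mulmxA _ P) PP mul1mx -mulmxA QQ mulmx1.
have sG : spectral_norm G <= spectral_norm F by exact: spectral_norm_unitary_le.
have [mu fE] := cauchy_stieltjes_real fCS.
have a20 : 0 < 2 * a by rewrite mulr_gt0.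
have [_ f2a] := fE _ a20; set r := Rintegral _ _ _ in f2a.
have r0 : 0 <= r.
  apply: Rintegral_ge0 => t /=; rewrite in_itv/= andbT => t0.
  by rewrite invr_ge0 addr_ge0// ltW.
have XE : X = P^t* *m (\matrix_(i, j) (f (al i + be j)%:C * G i j)) *m Q.
  by rewrite /X FG; exact: mxfun_sylvester.
pose D q : 'M[R[i]]_n := diag_mx (\row_j (h q (be j))%:C).
(* As [G] has the right factor [VF^T *m Q^t*], the condition on [G] for each of the [l] indices
   follows from [k] linear equations on [v]: [l * k] rows in all. *)
have [K rK Kker] := stack_kernel (fun q : 'I_l => VF^T *m Q^t* *m D q *m Q).
have sX : sigma (1 + l * k) X <= kp ^+ 2 * spectral_norm G * r.
  apply: sigma_le rK _ => [|v Kv].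
    by rewrite !mulr_ge0 ?sqr_ge0 ?spectral_norm_ge0.
  rewrite XE -!mulmxA (sqn_unitary _ Pu') -(sqn_unitary v Qu).
  rewrite (_ : r = complex.Re (f (2 * a)%:C)); last by rewrite f2a.
  apply: (stieltjes_sylvester_bound (b := b) (U := U) (W := W) (g := g) (h := h)) => //.
    by move=> i; case/andP: (alab i).
    exact: ker.
  move=> q ql; have := Kker v Kv (Ordinal ql); rewrite -!mulmxA /= => h0.
  by rewrite -/(D q) /G FE -!mulmxA h0 !mulmx0.
rewrite f2a (_ : (4 : R[i]) = (4 : R)%:C); last by rewrite rmorph_nat.
rewrite -!rmorphM/= lecR; apply: le_trans sX _.
rewrite (_ : 4 * r * _ = 4 * rho a (2 * b) ^+ l * spectral_norm F * r); last by ring.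
rewrite ler_wpM2r//.
(* The bounds on [U] and [W] contribute [kp] each: the constant is [2 ^ 2], and squaring doubles the
   exponent to that of [rho]. *)
suff -> : kp ^+ 2 = 4 * rho a (2 * b) ^+ l.
  by rewrite ler_wpM2l// mulr_ge0// exprn_ge0// expR_ge0.
rewrite /kp exprMn /rho -!expRM_natl; congr (_ * _); first by ring.
congr expR; rewrite (_ : 4 * (2 * b) / a = 8 * b / a); last by ring.
by rewrite invfM; move: (ln _)^-1 pi => x p; field.
Qed.
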